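(* Let $S$ be a finite semigroup, $k$ a commutative semiring with unit, and let $E=\{e_J\mid J\in\mathscr U(S)\}$ be an idempotent transversal to the set $\mathscr U(S)$ of regular $\mathscr J$-classes of $S$ (so $e_J\in J$ is an idempotent for each $J\in\mathscr U(S)$). For $J\in\mathscr U(S)$ let $G_J$ be the maximal subgroup of $S$ at $e_J$, let $A_J=kS/kJ^{\not\uparrow}$, and for a right $kG_J$-module $V$ define right $kS$-modules $$\mathrm{Ind}_J(V)=V\otimes_{kG_J}e_JA_J,\qquad \mathrm{Coind}_J(V)=\mathrm{Hom}_{kG_J}(A_Je_J,V).$$ Then for every $J\in\mathscr U(S)$: (1) If $M$ is an irreducible (respectively minimal) $kS$-module with apex $J$, then $Me_J$ is an irreducible (respectively minimal) $kG_J$-module. (2) If $V$ is an irreducible $kG_J$-module, then $$N=\{(u,v)\in \mathrm{Ind}_J(V)\times\mathrm{Ind}_J(V)\mid uae_J=vae_J \text{ for all } a\in A_J\}$$ is the unique maximal (proper) congruence on $\mathrm{Ind}_J(V)$, and $\mathrm{Ind}_J(V)/N$ is the unique (up to isomorphism) irreducible $kS$-module $M$ with apex $J$ such that $Me_J\cong V$. (3) If $V$ is an irreducible $kG_J$-module, then the unique minimal $kS$-submodule of $\mathrm{Coind}_J(V)$ is $\mathrm{Coind}_J(V)e_JkS$, which moreover is the unique (up to isomorphism) irreducible $kS$-module $M$ with apex $J$ such that $Me_J\cong V$. (4) If $V$ is a minimal $kG_J$-module, then $$K=\{m\in\mathrm{Ind}_J(V)\mid mae_J=0\text{ for all }a\in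 A_J\}$$ is the unique maximal (proper) $kS$-submodule of $\mathrm{Ind}_J(V)$. Moreover, the minimal $kS$-modules $M$ with apex $J$ such that $Me_J\cong V$ are, up to isomorphism, the quotients $\mathrm{Ind}_J(V)/R$ with $R$ a congruence on $\mathrm{Ind}_J(V)$ such that $R\subseteq N$ (with $N$ defined by the formula in (2)) and $K$ is contained in a single class of $R$. Consequently, there is a bijection between (isomorphism classes of) irreducible $kS$-modules and (isomorphism classes of) irreducible $kG_J$-modules, where $J$ runs over $\mathscr U(S)$.
   Context: A $k$-module over a commutative semiring $k$ with unit is a commutative additive monoid with zero $0$ and a unital action of $k$ that is distributive in both variables and satisfies $0m=0$ and $c0=0$. A $k$-algebra $A$ (not necessarily unital) is a $k$-module with an associative $k$-bilinear multiplication. Modules over $A$ are right modules; if $A$ is unital, modules are required to be unitary. A congruence on an $A$-module is an equivalence relation compatible with addition and with the actions of $k$ and $A$; it is proper if it has more than one class and trivial if all classes are singletons. An $A$-module $M$ with $MA\neq 0$ is simple if its only proper congruence is the trivial one, minimal if its only submodules are $0$ and $M$, and irreducible if it is both simple and minimal. $kS$ is the semigroup algebra: the free $k$-module on $S$ with multiplication extending that of $S$. Elements $s,t\in S$ are $\mathscr J$-equivalent if $S^1sS^1=S^1tS^1$, where $S^1$ is $S$ with an adjoined identity. A $\mathscr J$-class is regular if it contains an idempotent. For a $\mathscr J$-class $J$, $J^{\not\uparrow}=\{s\in S\mid J\nsubseteq S^1sS^1\}$, which is a (possibly empty) ideal of $S$; $kS/kJ^{\not\uparrow}$ is the quotient of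 $kS$ identifying elements $x,y$ when $x+n=y+n'$ for some $n,n'\in kJ^{\not\uparrow}$. The maximal subgroup at an idempotent $e$ is the group of units of the monoid $eSe$; one has $e_JA_Je_J=kG_J$. For a $kS$-module $M$, $\mathrm{Ann}_S(M)=\{s\in S\mid Ms=0\}$; a regular $\mathscr J$-class $J$ is the apex of $M$ if $\mathrm{Ann}_S(M)=J^{\not\uparrow}$. The action on $\mathrm{Coind}_J(V)$ is $(\varphi a)(x)=\varphi(ax)$. *)

(* Defs.v *)
From HB Require Import structures.
From mathcomp Require Import all_boot ssralg.
From mathcomp Require Import boolp.

Set Implicit Arguments.
Unset Strict Implicit.
Unset Printing Implicit Defensive.

Import GRing.Theory.
Local Open Scope ring_scope.
Local Open Scope quotient_scope.

Reserved Notation "m ** a" (at level 40, left associativity).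
Reserved Notation "M ~= N" (at level 70, no associativity).

Section KModules.
Variable k : comPzSemiRingType.

Record ksub (M : lSemiModType k) := KSub {
  ksub_pred :> M -> Prop;
  ksub0 : ksub_pred 0;
  ksubD : forall x y, ksub_pred x -> ksub_pred y -> ksub_pred (x + y);
  ksubZ : forall c x, ksub_pred x -> ksub_pred (c *: x) }.

Section SubCarrier.
Variables (M : lSemiModType k) (W : ksub M).

Definition ksub_mem : {pred M} := fun x => `[< W x >].

Record ksub_car := KSubCar { ksval :> M; ksvalP : ksval \in ksub_mem }.

HB.instance Definition _ := [isSub for ksval].
HB.instance Definition _ := [Choice of ksub_car by <:].

Fact ksub_mem_closed : subsemimod_closed ksub_mem.
Proof.
split; first split.
- exact/asboolP/ksub0.
- by move=> x y /asboolP Wx /asboolP Wy; apply/asboolP/ksubD.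
- by move=> c x /asboolP Wx; apply/asboolP/ksubZ.
Qed.

HB.instance Definition _ :=
  GRing.SubChoice_isSubLSemiModule.Build k M ksub_mem ksub_car ksub_mem_closed.

Definition ksub_mod : lSemiModType k := ksub_car.

Definition ksub_in (x : M) (Wx : W x) : ksub_car := KSubCar (asboolT Wx).

Lemma ksub_valP (x : ksub_car) : W (ksval x).
Proof. exact/asboolP/ksvalP. Qed.

Lemma ksval_inj : injective ksval.
Proof. exact: val_inj. Qed.

End SubCarrier.

Record kcong (M : lSemiModType k) := KCong {
  krel :> M -> M -> Prop;
  krefl : forall x, krel x x;
  ksym : forall x y, krel x y -> krel y x;
  ktrans : forall x y z, krel x y -> krel y z -> krel x z;
  kcongD : forall x y x' y', krel x y -> krel x' y' -> krel (x + x') (y + y');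
  kcongZ : forall c x y, krel x y -> krel (c *: x) (c *: y) }.

Section Quotient.
Variables (M : lSemiModType k) (R : kcong M).

Definition krelb : rel M := fun x y => `[< R x y >].

Fact krelb_refl : reflexive krelb.
Proof. by move=> x; apply/asboolP/krefl. Qed.
Fact krelb_sym : symmetric krelb.
Proof. by move=> x y; apply/asboolP/asboolP; apply: ksym. Qed.
Fact krelb_trans : transitive krelb.
Proof. by move=> y x z /asboolP xy /asboolP yz; apply/asboolP/(ktrans xy). Qed.

Canonical krelb_equiv := EquivRel krelb krelb_refl krelb_sym krelb_trans.

Definition kquot := {eq_quot krelb_equiv}.
HB.instance Definition _ := Choice.on kquot.
HB.instance Definition _ := EqQuotient.on kquot.

Definition kpi (x : M) : kquot := \pi_kquot x.

Lemma kpiP (x y : M) : kpi x = kpi y <-> R x y.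
Proof.
split=> [/eqquotP/asboolP//|Rxy].
by apply/eqquotP/asboolP.
Qed.

Lemma kpi_surj (u : kquot) : exists x, kpi x = u.
Proof. by exists (repr u); rewrite /kpi reprK. Qed.

Lemma repr_kpi (x : M) : R (repr (kpi x)) x.
Proof. by apply/kpiP; rewrite /kpi reprK. Qed.

Definition kquot_add (u v : kquot) := kpi (repr u + repr v).
Definition kquot_scale c (u : kquot) := kpi (c *: repr u).

Lemma kquot_addE x y : kquot_add (kpi x) (kpi y) = kpi (x + y).
Proof. by apply/kpiP/kcongD; apply: repr_kpi. Qed.

Lemma kquot_scaleE c x : kquot_scale c (kpi x) = kpi (c *: x).
Proof. by apply/kpiP/kcongZ/repr_kpi. Qed.

Fact kquot_addA : associative kquot_add.
Proof.
move=> u v w; have [x <-] := kpi_surj u; have [y <-] := kpi_surj v.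
by have [z <-] := kpi_surj w; rewrite !kquot_addE addrA.
Qed.
Fact kquot_addC : commutative kquot_add.
Proof.
move=> u v; have [x <-] := kpi_surj u; have [y <-] := kpi_surj v.
by rewrite !kquot_addE addrC.
Qed.
Fact kquot_add0 : left_id (kpi 0) kquot_add.
Proof. by move=> u; have [x <-] := kpi_surj u; rewrite kquot_addE add0r. Qed.

HB.instance Definition _ :=
  GRing.isNmodule.Build kquot kquot_addA kquot_addC kquot_add0.

Fact kquot_scaleA a b u :
  kquot_scale a (kquot_scale b u) = kquot_scale (a * b) u.
Proof. by have [x <-] := kpi_surj u; rewrite !kquot_scaleE scalerA. Qed.
Fact kquot_scale0 u : kquot_scale 0 u = 0.
Proof. by have [x <-] := kpi_surj u; rewrite kquot_scaleE scale0r. Qed.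
Fact kquot_scale1 : left_id 1 kquot_scale.
Proof. by move=> u; have [x <-] := kpi_surj u; rewrite kquot_scaleE scale1r. Qed.
Fact kquot_scaleDr : right_distributive kquot_scale +%R.
Proof.
move=> c u v; have [x <-] := kpi_surj u; have [y <-] := kpi_surj v.
by rewrite [kpi x + _]kquot_addE !kquot_scaleE [RHS]kquot_addE scalerDr.
Qed.
Fact kquot_scaleDl u : {morph kquot_scale^~ u : a b / a + b}.
Proof.
move=> a b /=; have [x <-] := kpi_surj u.
by rewrite !kquot_scaleE [RHS]kquot_addE scalerDl.
Qed.

HB.instance Definition _ := GRing.Nmodule_isLSemiModule.Build k kquot
  kquot_scaleA kquot_scale0 kquot_scale1 kquot_scaleDr kquot_scaleDl.

Definition kquot_mod : lSemiModType k := kquot.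

Lemma kpiD x y : kpi (x + y) = kpi x + kpi y.
Proof. by rewrite -kquot_addE. Qed.
Lemma kpiZ c x : kpi (c *: x) = c *: kpi x.
Proof. by rewrite -kquot_scaleE. Qed.

End Quotient.

End KModules.

Section Algebras.
Variable k : comPzSemiRingType.

Record algebra := Algebra {
  alg_car :> lSemiModType k;
  amul : alg_car -> alg_car -> alg_car;
  amulA : associative amul;
  amulDl : left_distributive amul +%R;
  amulDr : right_distributive amul +%R;
  amulZl : forall c a b, amul (c *: a) b = c *: amul a b;
  amulZr : forall c a b, amul a (c *: b) = c *: amul a b }.

Definition is_unity (A : algebra) (u : A) :=
  forall a : A, amul u a = a /\ amul a u = a.

(* Right modules; when A happens to be unital, the module has to be unitary.  *)
Record rmodule (A : algebra) := RModule {
  rmod_car :> lSemiModType k;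
  ract : rmod_car -> A -> rmod_car;
  ractA : forall m a b, ract (ract m a) b = ract m (amul a b);
  ractDl : forall m n a, ract (m + n) a = ract m a + ract n a;
  ractDr : forall m a b, ract m (a + b) = ract m a + ract m b;
  ractZl : forall c m a, ract (c *: m) a = c *: ract m a;
  ractZr : forall c m a, ract m (c *: a) = c *: ract m a;
  ract1 : forall u, is_unity u -> forall m, ract m u = m }.

Record bimodule (B A : algebra) := Bimodule {
  bimod_car :> lSemiModType k;
  blact : B -> bimod_car -> bimod_car;
  bract : bimod_car -> A -> bimod_car;
  blactA : forall b b' x, blact b (blact b' x) = blact (amul b b') x;
  blactDl : forall b b' x, blact (b + b') x = blact b x + blact b' x;
  blactDr : forall b x y, blact b (x + y) = blact b x + blact b y;
  blactZl : forall c b x, blact (c *: b) x = c *: blact b x;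
  blactZr : forall c b x, blact b (c *: x) = c *: blact b x;
  blact1 : forall u, is_unity u -> forall x, blact u x = x;
  bractA : forall x a a', bract (bract x a) a' = bract x (amul a a');
  bractDl : forall x y a, bract (x + y) a = bract x a + bract y a;
  bractDr : forall x a a', bract x (a + a') = bract x a + bract x a';
  bractZl : forall c x a, bract (c *: x) a = c *: bract x a;
  bractZr : forall c x a, bract x (c *: a) = c *: bract x a;
  bract1 : forall u, is_unity u -> forall x, bract x u = x;
  blractA : forall b x a, bract (blact b x) a = blact b (bract x a) }.

Definition bimod_right (B A : algebra) (X : bimodule B A) : rmodule A :=
  RModule (@bractA B A X) (@bractDl B A X) (@bractDr B A X) (@bractZl B A X)
    (@bractZr B A X) (@bract1 B A X).

Lemma amul0l (A : algebra) (a : A) : amul 0 a = 0.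
Proof. by rewrite -[X in amul X a](scale0r (0 : A)) amulZl scale0r. Qed.

Lemma amul0r (A : algebra) (a : A) : amul a 0 = 0.
Proof. by rewrite -[X in amul a X](scale0r (0 : A)) amulZr scale0r. Qed.

Lemma ract0l (A : algebra) (M : rmodule A) (a : A) : ract (0 : M) a = 0.
Proof. by rewrite -[X in ract X a](scale0r (0 : M)) ractZl scale0r. Qed.

Lemma ract0r (A : algebra) (M : rmodule A) (m : M) : ract m 0 = 0.
Proof. by rewrite -[X in ract m X](scale0r (0 : A)) ractZr scale0r. Qed.

Record alghom (A B : algebra) := AlgHom {
  ahom_fun :> A -> B;
  ahom_linear : semilinear ahom_fun;
  ahomM : forall a b, ahom_fun (amul a b) = amul (ahom_fun a) (ahom_fun b) }.

HB.instance Definition _ (A B : algebra) (f : alghom A B) :=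
  GRing.isSemilinear.Build k A B *:%R (ahom_fun f) (ahom_linear f).

Record rhom (A : algebra) (M N : rmodule A) := RHom {
  rhom_fun :> M -> N;
  rhom_linear : semilinear rhom_fun;
  rhom_act : forall m a, rhom_fun (ract m a) = ract (rhom_fun m) a }.

HB.instance Definition _ (A : algebra) (M N : rmodule A) (f : rhom M N) :=
  GRing.isSemilinear.Build k M N *:%R (rhom_fun f) (rhom_linear f).

Definition riso (A : algebra) (M N : rmodule A) :=
  exists f : rhom M N, bijective f.

Record congruence (A : algebra) (M : rmodule A) := Congruence {
  cong_k :> kcong M;
  cong_act : forall x y a, cong_k x y -> cong_k (ract x a) (ract y a) }.

Record submodule (A : algebra) (M : rmodule A) := Submodule {
  submod_k :> ksub M;
  submod_act : forall x a, submod_k x -> submod_k (ract x a) }.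

Definition unique_up_to_iso (A : algebra) (P : rmodule A -> Prop)
    (M : rmodule A) :=
  P M /\ forall M', P M' -> riso M' M.

Section Irreducibility.
Variables (A : algebra) (M : rmodule A).

Definition cong_proper (R : congruence M) := exists x y, ~ R x y.
Definition cong_trivial (R : congruence M) := forall x y, R x y -> x = y.

Definition submod_zero (W : submodule M) := forall x, W x -> x = 0.
Definition submod_full (W : submodule M) := forall x, W x.

Definition nonzero_action := exists (m : M) (a : A), ract m a <> 0.

Definition simple :=
  nonzero_action /\ (forall R : congruence M, cong_proper R -> cong_trivial R).
Definition minimal :=
  nonzero_action /\ (forall W : submodule M, submod_zero W \/ submod_full W).
Definition irreducible := simple /\ minimal.

Definition maximal_cong (R : congruence M) :=
  cong_proper R /\
  forall R' : congruence M, cong_proper R' ->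
    (forall x y, R x y -> R' x y) -> forall x y, R' x y -> R x y.

Definition unique_maximal_cong (R : congruence M) :=
  maximal_cong R /\
  forall R', maximal_cong R' -> forall x y, R' x y <-> R x y.

Definition maximal_submod (W : submodule M) :=
  ~ submod_full W /\
  forall W' : submodule M, ~ submod_full W' ->
    (forall x, W x -> W' x) -> forall x, W' x -> W x.

Definition unique_maximal_submod (W : submodule M) :=
  maximal_submod W /\ forall W', maximal_submod W' -> forall x, W' x <-> W x.

Definition minimal_submod (W : submodule M) :=
  ~ submod_zero W /\
  forall W' : submodule M, ~ submod_zero W' ->
    (forall x, W' x -> W x) -> forall x, W x -> W' x.

Definition unique_minimal_submod (W : submodule M) :=
  minimal_submod W /\ forall W', minimal_submod W' -> forall x, W' x <-> W x.

End Irreducibility.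

Section QuotientModule.
Variables (A : algebra) (M : rmodule A) (R : congruence M).

Definition rquot_act (u : kquot_mod R) (a : A) : kquot_mod R :=
  kpi R (ract (repr u) a).

Lemma rquot_actE x a : rquot_act (kpi R x) a = kpi R (ract x a).
Proof. by apply/kpiP/cong_act/repr_kpi. Qed.

Fact rquot_actA u a b : rquot_act (rquot_act u a) b = rquot_act u (amul a b).
Proof. by have [x <-] := kpi_surj u; rewrite !rquot_actE ractA. Qed.
Fact rquot_actDl u v a : rquot_act (u + v) a = rquot_act u a + rquot_act v a.
Proof.
have [x <-] := kpi_surj u; have [y <-] := kpi_surj v.
by rewrite -kpiD !rquot_actE ractDl kpiD.
Qed.
Fact rquot_actDr u a b : rquot_act u (a + b) = rquot_act u a + rquot_act u b.
Proof. by have [x <-] := kpi_surj u; rewrite !rquot_actE ractDr kpiD. Qed.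
Fact rquot_actZl c u a : rquot_act (c *: u) a = c *: rquot_act u a.
Proof. by have [x <-] := kpi_surj u; rewrite -kpiZ !rquot_actE ractZl kpiZ. Qed.
Fact rquot_actZr c u a : rquot_act u (c *: a) = c *: rquot_act u a.
Proof. by have [x <-] := kpi_surj u; rewrite !rquot_actE ractZr kpiZ. Qed.
Fact rquot_act1 u : is_unity u -> forall m, rquot_act m u = m.
Proof. by move=> u1 m; have [x <-] := kpi_surj m; rewrite rquot_actE ract1. Qed.

Definition rquot : rmodule A :=
  RModule rquot_actA rquot_actDl rquot_actDr rquot_actZl rquot_actZr rquot_act1.

End QuotientModule.

Section SubmoduleModule.
Variables (A : algebra) (M : rmodule A) (W : submodule M).

Definition rsub_act (x : ksub_mod W) (a : A) : ksub_mod W :=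
  ksub_in (submod_act a (ksub_valP x)).

Fact rsub_actA x a b : rsub_act (rsub_act x a) b = rsub_act x (amul a b).
Proof. by apply: ksval_inj; rewrite /= ractA. Qed.
Fact rsub_actDl x y a : rsub_act (x + y) a = rsub_act x a + rsub_act y a.
Proof. by apply: ksval_inj; rewrite /= ractDl. Qed.
Fact rsub_actDr x a b : rsub_act x (a + b) = rsub_act x a + rsub_act x b.
Proof. by apply: ksval_inj; rewrite /= ractDr. Qed.
Fact rsub_actZl c x a : rsub_act (c *: x) a = c *: rsub_act x a.
Proof. by apply: ksval_inj; rewrite /= ractZl. Qed.
Fact rsub_actZr c x a : rsub_act x (c *: a) = c *: rsub_act x a.
Proof. by apply: ksval_inj; rewrite /= ractZr. Qed.
Fact rsub_act1 u : is_unity u -> forall x, rsub_act x u = x.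
Proof. by move=> u1 x; apply: ksval_inj; rewrite /= ract1. Qed.

Definition rsub : rmodule A :=
  RModule rsub_actA rsub_actDl rsub_actDr rsub_actZl rsub_actZr rsub_act1.

End SubmoduleModule.

(* X A, the additive span of the products x a with x in X and a in A          *)
Section Span.
Variables (A : algebra) (M : rmodule A) (X : M -> Prop).

Definition xspan_pred (m : M) := exists s : seq (M * A),
  (forall p, p \in s -> X p.1) /\ m = \sum_(p <- s) ract p.1 p.2.

Fact xspan0 : xspan_pred 0.
Proof. by exists [::]; split=> //; rewrite big_nil. Qed.
Fact xspanD x y : xspan_pred x -> xspan_pred y -> xspan_pred (x + y).
Proof.
move=> [s [sX ->]] [t [tX ->]]; exists (s ++ t); rewrite big_cat; split=> // p.
by rewrite mem_cat => /orP[/sX|/tX].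
Qed.
Fact xspanZ c x : xspan_pred x -> xspan_pred (c *: x).
Proof.
move=> [s [sX ->]]; exists [seq (p.1, c *: p.2) | p <- s]; split.
  by move=> _ /mapP[p /sX Xp ->].
by rewrite big_map scaler_sumr; apply: eq_bigr => p _ /=; rewrite ractZr.
Qed.

Definition xspan_k : ksub M := KSub xspan0 xspanD xspanZ.

Fact xspan_act x a : xspan_k x -> xspan_k (ract x a).
Proof.
move=> [s [sX ->]]; exists [seq (p.1, amul p.2 a) | p <- s]; split.
  by move=> _ /mapP[p /sX Xp ->].
rewrite big_map; elim: s {sX} => [|p s IH]; first by rewrite !big_nil ract0l.
by rewrite !big_cons ractDl IH ractA.
Qed.

Definition xspan : submodule M := Submodule xspan_act.

End Span.

(* Restriction of scalars along a surjective homomorphism f; surjectivity     *)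
(* keeps the restricted module unitary.                                       *)
Section Inflation.
Variables (A B : algebra) (f : alghom A B) (fS : forall b, exists a, f a = b).
Variable M : rmodule B.

Definition infl_act (m : M) (a : A) : M := ract m (f a).

Fact infl_actA m a b : infl_act (infl_act m a) b = infl_act m (amul a b).
Proof. by rewrite /infl_act ractA ahomM. Qed.
Fact infl_actDl m n a : infl_act (m + n) a = infl_act m a + infl_act n a.
Proof. exact: ractDl. Qed.
Fact infl_actDr m a b : infl_act m (a + b) = infl_act m a + infl_act m b.
Proof. by rewrite /infl_act raddfD ractDr. Qed.
Fact infl_actZl c m a : infl_act (c *: m) a = c *: infl_act m a.
Proof. exact: ractZl. Qed.
Fact infl_actZr c m a : infl_act m (c *: a) = c *: infl_act m a.
Proof. by rewrite /infl_act linearZ ractZr. Qed.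
Fact infl_act1 u : is_unity u -> forall m, infl_act m u = m.
Proof.
move=> u1 m; apply: ract1 => b; have [a <-] := fS b.
by rewrite -!ahomM; case: (u1 a) => -> ->.
Qed.

Definition inflation : rmodule A :=
  RModule infl_actA infl_actDl infl_actDr infl_actZl infl_actZr infl_act1.

End Inflation.

Record alg_cong (A : algebra) := AlgCong {
  acong_k :> kcong A;
  acongMl : forall a x y, acong_k x y -> acong_k (amul a x) (amul a y);
  acongMr : forall a x y, acong_k x y -> acong_k (amul x a) (amul y a) }.

Section QuotientAlgebra.
Variables (A : algebra) (R : alg_cong A).

Definition aquot_mul (u v : kquot_mod R) : kquot_mod R :=
  kpi R (amul (repr u) (repr v)).

Lemma aquot_mulE x y : aquot_mul (kpi R x) (kpi R y) = kpi R (amul x y).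
Proof.
apply/kpiP; apply: (@ktrans _ _ R _ (amul (repr (kpi R x)) y)).
  exact/acongMl/repr_kpi.
exact/acongMr/repr_kpi.
Qed.

Fact aquot_mulA : associative aquot_mul.
Proof.
move=> u v w; have [x <-] := kpi_surj u; have [y <-] := kpi_surj v.
by have [z <-] := kpi_surj w; rewrite !aquot_mulE amulA.
Qed.
Fact aquot_mulDl : left_distributive aquot_mul +%R.
Proof.
move=> u v w; have [x <-] := kpi_surj u; have [y <-] := kpi_surj v.
by have [z <-] := kpi_surj w; rewrite -kpiD !aquot_mulE amulDl kpiD.
Qed.
Fact aquot_mulDr : right_distributive aquot_mul +%R.
Proof.
move=> u v w; have [x <-] := kpi_surj u; have [y <-] := kpi_surj v.
by have [z <-] := kpi_surj w; rewrite -kpiD !aquot_mulE amulDr kpiD.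
Qed.
Fact aquot_mulZl c u v : aquot_mul (c *: u) v = c *: aquot_mul u v.
Proof.
have [x <-] := kpi_surj u; have [y <-] := kpi_surj v.
by rewrite -kpiZ !aquot_mulE amulZl kpiZ.
Qed.
Fact aquot_mulZr c u v : aquot_mul u (c *: v) = c *: aquot_mul u v.
Proof.
have [x <-] := kpi_surj u; have [y <-] := kpi_surj v.
by rewrite -kpiZ !aquot_mulE amulZr kpiZ.
Qed.

Definition aquot : algebra :=
  Algebra aquot_mulA aquot_mulDl aquot_mulDr aquot_mulZl aquot_mulZr.

Fact aproj_linear : semilinear (kpi R : A -> aquot).
Proof. by split=> [c x|x y]; [apply: kpiZ|apply: kpiD]. Qed.
Fact aprojM a b : (kpi R (amul a b) : aquot) = @amul aquot (kpi R a) (kpi R b).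
Proof. by rewrite /= aquot_mulE. Qed.

Definition aproj : alghom A aquot := AlgHom aproj_linear aprojM.

Lemma aproj_surj b : exists a, aproj a = b.
Proof. exact: kpi_surj. Qed.

End QuotientAlgebra.

Record ideal (A : algebra) := Ideal {
  ideal_k :> ksub A;
  idealMl : forall a x, ideal_k x -> ideal_k (amul a x);
  idealMr : forall a x, ideal_k x -> ideal_k (amul x a) }.

Section IdealQuotient.
Variables (A : algebra) (I : ideal A).

Definition ideal_rel (x y : A) :=
  exists n n' : A, [/\ I n, I n' & x + n = y + n'].

Fact ideal_rel_refl x : ideal_rel x x.
Proof. by exists 0, 0; split=> //; apply: ksub0. Qed.
Fact ideal_rel_sym x y : ideal_rel x y -> ideal_rel y x.
Proof. by move=> [n [n' [In In' e]]]; exists n', n. Qed.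
Fact ideal_rel_trans x y z : ideal_rel x y -> ideal_rel y z -> ideal_rel x z.
Proof.
move=> [n [n' [In In' e]]] [p [p' [Ip Ip' e']]].
exists (n + p), (p' + n'); split; try exact: ksubD.
by rewrite !addrA e (addrAC y) e'.
Qed.
Fact ideal_relD x y x' y' :
  ideal_rel x y -> ideal_rel x' y' -> ideal_rel (x + x') (y + y').
Proof.
move=> [n [n' [In In' e]]] [p [p' [Ip Ip' e']]].
exists (n + p), (n' + p'); split; try exact: ksubD.
by rewrite addrACA e e' addrACA.
Qed.
Fact ideal_relZ c x y : ideal_rel x y -> ideal_rel (c *: x) (c *: y).
Proof.
move=> [n [n' [In In' e]]]; exists (c *: n), (c *: n'); split; try exact: ksubZ.
by rewrite -!scalerDr e.
Qed.

Definition ideal_kcong : kcong A := KCong ideal_rel_refl ideal_rel_sym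
  ideal_rel_trans ideal_relD ideal_relZ.

Fact ideal_relMl a x y : ideal_kcong x y -> ideal_kcong (amul a x) (amul a y).
Proof.
move=> [n [n' [In In' e]]].
by exists (amul a n), (amul a n'); split; [exact: idealMl..|rewrite -!amulDr e].
Qed.
Fact ideal_relMr a x y : ideal_kcong x y -> ideal_kcong (amul x a) (amul y a).
Proof.
move=> [n [n' [In In' e]]].
by exists (amul n a), (amul n' a); split; [exact: idealMr..|rewrite -!amulDl e].
Qed.

Definition ideal_cong : alg_cong A := AlgCong ideal_relMl ideal_relMr.

End IdealQuotient.

Section Tensor.
Variables (B A : algebra) (V : rmodule B) (X : bimodule B A).

(* V (x)_B X is the quotient of the free commutative monoid on V * X by the   *)
(* least congruence making (v, x) |-> v (x) x k-bilinear and B-balanced;       *)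
(* words represent formal sums and tens_comm makes their order irrelevant.    *)
Inductive tens_rel : seq (V * X) -> seq (V * X) -> Prop :=
| tens_refl s : tens_rel s s
| tens_sym s t : tens_rel s t -> tens_rel t s
| tens_trans s t r : tens_rel s t -> tens_rel t r -> tens_rel s r
| tens_cat s t s' t' :
    tens_rel s t -> tens_rel s' t' -> tens_rel (s ++ s') (t ++ t')
| tens_comm s t : tens_rel (s ++ t) (t ++ s)
| tens_addl v v' x : tens_rel [:: (v + v', x)] [:: (v, x); (v', x)]
| tens_addr v x x' : tens_rel [:: (v, x + x')] [:: (v, x); (v, x')]
| tens_0l x : tens_rel [:: (0, x)] [::]
| tens_0r v : tens_rel [:: (v, 0)] [::]
| tens_scale c v x : tens_rel [:: (c *: v, x)] [:: (v, c *: x)]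
| tens_bal v b x : tens_rel [:: (ract v b, x)] [:: (v, blact b x)].

Definition tens_relb : rel (seq (V * X)) := fun s t => `[< tens_rel s t >].

Fact tens_relb_refl : reflexive tens_relb.
Proof. by move=> x; apply/asboolP/tens_refl. Qed.
Fact tens_relb_sym : symmetric tens_relb.
Proof. by move=> x y; apply/asboolP/asboolP; apply: tens_sym. Qed.
Fact tens_relb_trans : transitive tens_relb.
Proof. by move=> y x z /asboolP xy /asboolP yz; apply/asboolP/(tens_trans xy). Qed.

Canonical tens_relb_equiv :=
  EquivRel tens_relb tens_relb_refl tens_relb_sym tens_relb_trans.

Definition tens := {eq_quot tens_relb_equiv}.
HB.instance Definition _ := Choice.on tens.
HB.instance Definition _ := EqQuotient.on tens.

Definition tpi (s : seq (V * X)) : tens := \pi_tens s.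

Lemma tpiP s t : tpi s = tpi t <-> tens_rel s t.
Proof.
split=> [/eqquotP/asboolP//|Rst].
by apply/eqquotP/asboolP.
Qed.

Lemma tpi_surj (u : tens) : exists s, tpi s = u.
Proof. by exists (repr u); rewrite /tpi reprK. Qed.

Lemma repr_tpi s : tens_rel (repr (tpi s)) s.
Proof. by apply/tpiP; rewrite /tpi reprK. Qed.

Definition tmap (f : X -> X) (s : seq (V * X)) := [seq (p.1, f p.2) | p <- s].

Lemma tmap_rel (f : X -> X) s t :
  f 0 = 0 -> {morph f : x y / x + y} -> (forall c, {morph f : x / c *: x}) ->
  (forall b x, f (blact b x) = blact b (f x)) ->
  tens_rel s t -> tens_rel (tmap f s) (tmap f t).
Proof.
move=> f0 fD fZ fB; elim=> {s t}; rewrite /tmap /=.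
- by move=> s; apply: tens_refl.
- by move=> s t _; apply: tens_sym.
- by move=> s t r _ st _ /(tens_trans st).
- by move=> s t s' t' _ st _ s't'; rewrite !map_cat; apply: tens_cat.
- by move=> s t; rewrite !map_cat; apply: tens_comm.
- by move=> v v' x; apply: tens_addl.
- by move=> v x x'; rewrite fD; apply: tens_addr.
- by move=> x; apply: tens_0l.
- by move=> v; rewrite f0; apply: tens_0r.
- by move=> c v x; rewrite fZ; apply: tens_scale.
- by move=> v b x; rewrite fB; apply: tens_bal.
Qed.

Lemma tens_map2 (f g h : V * X -> V * X) s :
  (forall p, tens_rel [:: h p] [:: f p; g p]) ->
  tens_rel (map h s) (map f s ++ map g s).
Proof.
move=> hfg; elim: s => [|p s IH] /=; first exact: tens_refl.
apply: (tens_trans (tens_cat (hfg p) IH)) => /=.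
rewrite -[_ :: _ :: _]/([:: f p] ++ ([:: g p] ++ map f s) ++ map g s).
rewrite -[X in tens_rel _ X]/([:: f p] ++ (map f s ++ [:: g p] ++ map g s)).
apply: tens_cat; first exact: tens_refl.
by rewrite catA; apply: tens_cat; [exact: tens_comm|exact: tens_refl].
Qed.

Lemma tens_map0 (f : V * X -> V * X) s :
  (forall p, tens_rel [:: f p] [::]) -> tens_rel (map f s) [::].
Proof.
move=> f0; elim: s => [|p s IH] /=; first exact: tens_refl.
exact: (tens_cat (f0 p) IH).
Qed.

Definition tens_add (u v : tens) := tpi (repr u ++ repr v).
Lemma tens_addE s t : tens_add (tpi s) (tpi t) = tpi (s ++ t).
Proof. by apply/tpiP/tens_cat; apply: repr_tpi. Qed.

Fact tens_addA : associative tens_add.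
Proof.
move=> u v w; have [x <-] := tpi_surj u; have [y <-] := tpi_surj v.
by have [z <-] := tpi_surj w; rewrite !tens_addE catA.
Qed.
Fact tens_addC : commutative tens_add.
Proof.
move=> u v; have [x <-] := tpi_surj u; have [y <-] := tpi_surj v.
by rewrite !tens_addE; apply/tpiP/tens_comm.
Qed.
Fact tens_add0 : left_id (tpi [::]) tens_add.
Proof. by move=> u; have [x <-] := tpi_surj u; rewrite tens_addE. Qed.

HB.instance Definition _ :=
  GRing.isNmodule.Build tens tens_addA tens_addC tens_add0.

Lemma tpiD s t : tpi (s ++ t) = tpi s + tpi t.
Proof. by rewrite -tens_addE. Qed.

Definition tens_scl c (u : tens) := tpi (tmap ( *:%R c) (repr u)).

Lemma tens_sclE c s : tens_scl c (tpi s) = tpi (tmap ( *:%R c) s).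
Proof.
apply/tpiP/tmap_rel; last exact: repr_tpi.
- exact: scaler0.
- by move=> x y; rewrite scalerDr.
- by move=> d x; rewrite !scalerA mulrC.
- by move=> b x; rewrite blactZr.
Qed.

Fact tens_sclA a b u : tens_scl a (tens_scl b u) = tens_scl (a * b) u.
Proof.
have [s <-] := tpi_surj u; rewrite !tens_sclE /tmap -map_comp; congr tpi.
by apply: eq_map => p /=; rewrite scalerA.
Qed.
Fact tens_scl0 u : tens_scl 0 u = 0.
Proof.
have [s <-] := tpi_surj u; rewrite tens_sclE; apply/tpiP/tens_map0 => p.
by rewrite scale0r; apply: tens_0r.
Qed.
Fact tens_scl1 : left_id 1 tens_scl.
Proof.
move=> u; have [s <-] := tpi_surj u; rewrite tens_sclE /tmap; congr tpi.
by rewrite -[RHS]map_id; apply: eq_map => -[v x] /=; rewrite scale1r.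
Qed.
Fact tens_sclDr : right_distributive tens_scl +%R.
Proof.
move=> c u v; have [s <-] := tpi_surj u; have [t <-] := tpi_surj v.
by rewrite -tpiD !tens_sclE -tpiD /tmap map_cat.
Qed.
Fact tens_sclDl u : {morph tens_scl^~ u : a b / a + b}.
Proof.
move=> a b /=; have [s <-] := tpi_surj u; rewrite !tens_sclE -tpiD.
by apply/tpiP/tens_map2 => p; rewrite scalerDl; apply: tens_addr.
Qed.

HB.instance Definition _ := GRing.Nmodule_isLSemiModule.Build k tens
  tens_sclA tens_scl0 tens_scl1 tens_sclDr tens_sclDl.

Definition tens_mod : lSemiModType k := tens.

Definition tens_act (u : tens_mod) (a : A) : tens_mod :=
  tpi (tmap (fun x => bract x a) (repr u)).

Lemma tens_actE s a : tens_act (tpi s) a = tpi (tmap (fun x => bract x a) s).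
Proof.
apply/tpiP/tmap_rel; last exact: repr_tpi.
- by rewrite -[Y in bract Y a](scale0r (0 : X)) bractZl scale0r.
- by move=> x y; rewrite bractDl.
- by move=> d x; rewrite bractZl.
- by move=> b x; rewrite blractA.
Qed.

Fact tens_actA u a b : tens_act (tens_act u a) b = tens_act u (amul a b).
Proof.
have [s <-] := tpi_surj u; rewrite !tens_actE /tmap -map_comp; congr tpi.
by apply: eq_map => p /=; rewrite bractA.
Qed.
Fact tens_actDl u v a : tens_act (u + v) a = tens_act u a + tens_act v a.
Proof.
have [s <-] := tpi_surj u; have [t <-] := tpi_surj v.
by rewrite -tpiD !tens_actE -tpiD /tmap map_cat.
Qed.
Fact tens_actDr u a b : tens_act u (a + b) = tens_act u a + tens_act u b.
Proof.
have [s <-] := tpi_surj u; rewrite !tens_actE -tpiD.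
by apply/tpiP/tens_map2 => p; rewrite bractDr; apply: tens_addr.
Qed.
Fact tens_actZl c u a : tens_act (c *: u) a = c *: tens_act u a.
Proof.
have [s <-] := tpi_surj u; rewrite [c *: tpi s]tens_sclE !tens_actE.
rewrite [RHS]tens_sclE /tmap -!map_comp; congr tpi.
by apply: eq_map => p /=; rewrite bractZl.
Qed.
Fact tens_actZr c u a : tens_act u (c *: a) = c *: tens_act u a.
Proof.
have [s <-] := tpi_surj u; rewrite !tens_actE.
rewrite [RHS]tens_sclE /tmap -!map_comp; congr tpi.
by apply: eq_map => p /=; rewrite bractZr.
Qed.
Fact tens_act1 a : is_unity a -> forall u, tens_act u a = u.
Proof.
move=> a1 u; have [s <-] := tpi_surj u; rewrite tens_actE /tmap; congr tpi.
by rewrite -[RHS]map_id; apply: eq_map => -[v x] /=; rewrite bract1.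
Qed.

Definition tensor : rmodule A :=
  RModule tens_actA tens_actDl tens_actDr tens_actZl tens_actZr tens_act1.

End Tensor.

Section HomModule.
Variables (A B : algebra) (X : bimodule A B) (V : rmodule B).

Definition hom := rhom (bimod_right X) V.

HB.instance Definition _ := gen_eqMixin hom.
HB.instance Definition _ := gen_choiceMixin hom.

Lemma homP (f g : hom) : (forall x, f x = g x) -> f = g.
Proof.
case: f g => [f fl fa] [g gl ga] /= /funext fg.
case: g / fg gl ga => -[sg dg] ga; case: fl => [sf df].
by congr RHom; [congr pair|]; apply: Prop_irrelevance.
Qed.

Fact hom_zero_linear : semilinear (fun _ : bimod_right X => 0 : V).
Proof. by split=> [c x|x y]; rewrite ?scaler0 ?addr0. Qed.
Fact hom_zero_act (x : bimod_right X) (b : B) : (0 : V) = ract (0 : V) b.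
Proof. by rewrite ract0l. Qed.
Definition hom_zero : hom := RHom hom_zero_linear hom_zero_act.

Fact hom_add_linear (f g : hom) : semilinear (fun x => f x + g x).
Proof.
by split=> [c x|x y]; rewrite ?linearZ ?raddfD /= ?scalerDr // addrACA.
Qed.
Fact hom_add_act (f g : hom) (x : bimod_right X) (b : B) :
  f (ract x b) + g (ract x b) = ract (f x + g x) b.
Proof. by rewrite ractDl !rhom_act. Qed.
Definition hom_add (f g : hom) : hom :=
  RHom (hom_add_linear f g) (hom_add_act f g).

Fact hom_scale_linear c (f : hom) : semilinear (fun x => c *: f x).
Proof.
by split=> [d x|x y]; rewrite ?linearZ ?raddfD /= ?scalerDr // !scalerA mulrC.
Qed.
Fact hom_scale_act c (f : hom) (x : bimod_right X) (b : B) :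
  c *: f (ract x b) = ract (c *: f x) b.
Proof. by rewrite ractZl rhom_act. Qed.
Definition hom_scale c (f : hom) : hom :=
  RHom (hom_scale_linear c f) (hom_scale_act c f).

Fact hom_addA : associative hom_add.
Proof. by move=> f g h; apply: homP => x /=; rewrite addrA. Qed.
Fact hom_addC : commutative hom_add.
Proof. by move=> f g; apply: homP => x /=; rewrite addrC. Qed.
Fact hom_add0 : left_id hom_zero hom_add.
Proof. by move=> f; apply: homP => x /=; rewrite add0r. Qed.

HB.instance Definition _ := GRing.isNmodule.Build hom hom_addA hom_addC hom_add0.

Fact hom_scaleA a b f : hom_scale a (hom_scale b f) = hom_scale (a * b) f.
Proof. by apply: homP => x /=; rewrite scalerA. Qed.
Fact hom_scale0 f : hom_scale 0 f = 0.
Proof. by apply: homP => x /=; rewrite scale0r. Qed.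
Fact hom_scale1 : left_id 1 hom_scale.
Proof. by move=> f; apply: homP => x /=; rewrite scale1r. Qed.
Fact hom_scaleDr : right_distributive hom_scale +%R.
Proof. by move=> c f g; apply: homP => x /=; rewrite scalerDr. Qed.
Fact hom_scaleDl f : {morph hom_scale^~ f : a b / a + b}.
Proof. by move=> a b; apply: homP => x /=; rewrite scalerDl. Qed.

HB.instance Definition _ := GRing.Nmodule_isLSemiModule.Build k hom
  hom_scaleA hom_scale0 hom_scale1 hom_scaleDr hom_scaleDl.

Definition hom_mod : lSemiModType k := hom.

Fact hom_act_linear (f : hom) (a : A) : 
  semilinear (fun x : bimod_right X => f (blact a x) : V).
Proof.
split=> [c x|x y]; first by rewrite blactZr linearZ.
by rewrite blactDr raddfD.
Qed.
Fact hom_act_act (f : hom) (a : A) (x : bimod_right X) (b : B) :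
  f (blact a (ract x b)) = ract (f (blact a x)) b.
Proof. by rewrite /= -blractA -rhom_act. Qed.

Definition hom_act (f : hom_mod) (a : A) : hom_mod :=
  RHom (hom_act_linear f a) (hom_act_act f a).

Fact hom_actA f a b : hom_act (hom_act f a) b = hom_act f (amul a b).
Proof. by apply: homP => x /=; rewrite blactA. Qed.
Fact hom_actDl f g a : hom_act (f + g) a = hom_act f a + hom_act g a.
Proof. exact: homP. Qed.
Fact hom_actDr f a b : hom_act f (a + b) = hom_act f a + hom_act f b.
Proof. by apply: homP => x /=; rewrite blactDl raddfD. Qed.
Fact hom_actZl c f a : hom_act (c *: f) a = c *: hom_act f a.
Proof. exact: homP. Qed.
Fact hom_actZr c f a : hom_act f (c *: a) = c *: hom_act f a.
Proof. by apply: homP => x /=; rewrite blactZl linearZ. Qed.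
Fact hom_act1 u : is_unity u -> forall f, hom_act f u = f.
Proof. by move=> u1 f; apply: homP => x /=; rewrite blact1. Qed.

Definition hom_module : rmodule A :=
  RModule hom_actA hom_actDl hom_actDr hom_actZl hom_actZr hom_act1.

End HomModule.

(* A homomorphism B -> A carrying the identity of B to e in A restricts        *)
(* actions of A to actions of B on eA, Ae and Me.                              *)
Record corner (B A : algebra) := Corner {
  cmap :> alghom B A;
  ce : A;
  cone : B;
  cone_unity : is_unity cone;
  cmap1 : cmap cone = ce }.

Section CornerModules.
Variables (B A : algebra) (c : corner B A).
Local Notation e := (ce c).

Lemma ceM b : amul e (c b) = c b.
Proof. by rewrite -cmap1 -ahomM; case: (cone_unity c b) => ->. Qed.
Lemma Mce b : amul (c b) e = c b.
Proof. by rewrite -cmap1 -ahomM; case: (cone_unity c b) => _ ->. Qed.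
Lemma cee : amul e e = e.
Proof. by rewrite -{2}cmap1 ceM cmap1. Qed.
Lemma cmap_unity u : is_unity u -> c u = e.
Proof.
move=> u1; rewrite -cmap1; congr (c _).
by case: (u1 (cone c)) => _ <-; case: (cone_unity c u) => ->.
Qed.

Definition eA_pred (x : A) := exists a, x = amul e a.
Fact eA0 : eA_pred 0. Proof. by exists 0; rewrite amul0r. Qed.
Fact eAD x y : eA_pred x -> eA_pred y -> eA_pred (x + y).
Proof. by move=> [a ->] [b ->]; exists (a + b); rewrite amulDr. Qed.
Fact eAZ d x : eA_pred x -> eA_pred (d *: x).
Proof. by move=> [a ->]; exists (d *: a); rewrite amulZr. Qed.
Definition eA_k : ksub A := KSub eA0 eAD eAZ.

Lemma eA_e x : eA_k x -> amul e x = x.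
Proof. by move=> [a ->]; rewrite amulA cee. Qed.

Fact eA_lact_in b (x : ksub_mod eA_k) : eA_k (amul (c b) (ksval x)).
Proof. by exists (amul (c b) (ksval x)); rewrite amulA ceM. Qed.
Fact eA_ract_in (x : ksub_mod eA_k) a : eA_k (amul (ksval x) a).
Proof. by exists (amul (ksval x) a); rewrite amulA eA_e //; apply: ksub_valP. Qed.

Definition eA_lact b x : ksub_mod eA_k := ksub_in (eA_lact_in b x).
Definition eA_ract x a : ksub_mod eA_k := ksub_in (eA_ract_in x a).

Definition eA : bimodule B A.
Proof.
refine (@Bimodule B A (ksub_mod eA_k) eA_lact eA_ract _ _ _ _ _ _ _ _ _ _ _ _ _).
- by move=> b b' x; apply: ksval_inj; rewrite /= amulA ahomM.
- by move=> b b' x; apply: ksval_inj; rewrite /= raddfD amulDl.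
- by move=> b x y; apply: ksval_inj; rewrite /= amulDr.
- by move=> d b x; apply: ksval_inj; rewrite /= linearZ amulZl.
- by move=> d b x; apply: ksval_inj; rewrite /= amulZr.
- move=> u u1 x; apply: ksval_inj; rewrite /= cmap_unity //.
  exact/eA_e/ksub_valP.
- by move=> x a a'; apply: ksval_inj; rewrite /= amulA.
- by move=> x y a; apply: ksval_inj; rewrite /= amulDl.
- by move=> x a a'; apply: ksval_inj; rewrite /= amulDr.
- by move=> d x a; apply: ksval_inj; rewrite /= amulZl.
- by move=> d x a; apply: ksval_inj; rewrite /= amulZr.
- by move=> u u1 x; apply: ksval_inj => /=; case: (u1 (ksval x)).
- by move=> b x a; apply: ksval_inj; rewrite /= amulA.
Defined.

Definition Ae_pred (x : A) := exists a, x = amul a e.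
Fact Ae0 : Ae_pred 0. Proof. by exists 0; rewrite amul0l. Qed.
Fact AeD x y : Ae_pred x -> Ae_pred y -> Ae_pred (x + y).
Proof. by move=> [a ->] [b ->]; exists (a + b); rewrite amulDl. Qed.
Fact AeZ d x : Ae_pred x -> Ae_pred (d *: x).
Proof. by move=> [a ->]; exists (d *: a); rewrite amulZl. Qed.
Definition Ae_k : ksub A := KSub Ae0 AeD AeZ.

Lemma Ae_e x : Ae_k x -> amul x e = x.
Proof. by move=> [a ->]; rewrite -amulA cee. Qed.

Fact Ae_lact_in a (x : ksub_mod Ae_k) : Ae_k (amul a (ksval x)).
Proof. by exists (amul a (ksval x)); rewrite -amulA Ae_e //; apply: ksub_valP. Qed.
Fact Ae_ract_in (x : ksub_mod Ae_k) b : Ae_k (amul (ksval x) (c b)).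
Proof. by exists (amul (ksval x) (c b)); rewrite -amulA Mce. Qed.

Definition Ae_lact a x : ksub_mod Ae_k := ksub_in (Ae_lact_in a x).
Definition Ae_ract x b : ksub_mod Ae_k := ksub_in (Ae_ract_in x b).

Definition Ae : bimodule A B.
Proof.
refine (@Bimodule A B (ksub_mod Ae_k) Ae_lact Ae_ract _ _ _ _ _ _ _ _ _ _ _ _ _).
- by move=> b b' x; apply: ksval_inj; rewrite /= amulA.
- by move=> b b' x; apply: ksval_inj; rewrite /= amulDl.
- by move=> b x y; apply: ksval_inj; rewrite /= amulDr.
- by move=> d b x; apply: ksval_inj; rewrite /= amulZl.
- by move=> d b x; apply: ksval_inj; rewrite /= amulZr.
- by move=> u u1 x; apply: ksval_inj => /=; case: (u1 (ksval x)).
- by move=> x a a'; apply: ksval_inj; rewrite /= -amulA ahomM.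
- by move=> x y a; apply: ksval_inj; rewrite /= amulDl.
- by move=> x a a'; apply: ksval_inj; rewrite /= raddfD amulDr.
- by move=> d x a; apply: ksval_inj; rewrite /= amulZl.
- by move=> d x a; apply: ksval_inj; rewrite /= linearZ amulZr.
- move=> u u1 x; apply: ksval_inj; rewrite /= cmap_unity //.
  exact/Ae_e/ksub_valP.
- by move=> b x a; apply: ksval_inj; rewrite /= amulA.
Defined.

Variable M : rmodule A.

Definition Me_pred (x : M) := exists m, x = ract m e.
Fact Me0 : Me_pred 0. Proof. by exists 0; rewrite ract0l. Qed.
Fact MeD x y : Me_pred x -> Me_pred y -> Me_pred (x + y).
Proof. by move=> [a ->] [b ->]; exists (a + b); rewrite ractDl. Qed.
Fact MeZ d x : Me_pred x -> Me_pred (d *: x).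
Proof. by move=> [a ->]; exists (d *: a); rewrite ractZl. Qed.
Definition Me_k : ksub M := KSub Me0 MeD MeZ.

Fact Me_act_in (x : ksub_mod Me_k) b : Me_k (ract (ksval x) (c b)).
Proof. by exists (ract (ksval x) (c b)); rewrite ractA Mce. Qed.

Definition Me_act x b : ksub_mod Me_k := ksub_in (Me_act_in x b).

Definition Me : rmodule B.
Proof.
refine (@RModule B (ksub_mod Me_k) Me_act _ _ _ _ _ _).
- by move=> x a a'; apply: ksval_inj; rewrite /= ractA ahomM.
- by move=> x y a; apply: ksval_inj; rewrite /= ractDl.
- by move=> x a a'; apply: ksval_inj; rewrite /= raddfD ractDr.
- by move=> d x a; apply: ksval_inj; rewrite /= ractZl.
- by move=> d x a; apply: ksval_inj; rewrite /= linearZ ractZr.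
- move=> u u1 x; apply: ksval_inj; rewrite /= cmap_unity //.
  by have [m ->] := ksub_valP x; rewrite ractA cee.
Defined.

End CornerModules.

End Algebras.

Notation "m ** a" := (ract m a) : ring_scope.
Notation "M ~= N" := (riso M N) : ring_scope.

Record irr_class (k : comPzSemiRingType) (A : algebra k) := IrrClass {
  irr_mem :> rmodule A -> Prop;
  irr_memP : exists M, irreducible M /\ (forall M', irr_mem M' <-> M' ~= M) }.

#[short(type="finSemigroupType")]
HB.structure Definition FinSemigroup := {S of Semigroup S & Finite S}.

Section Green.
Variable S : finSemigroupType.
Local Open Scope group_scope.

(* S^1 is option S, with None the adjoined identity                           *)
Definition mul1l (x : option S) (s : S) := if x is Some x' then x' * s else s.
Definition mul1r (s : S) (y : option S) := if y is Some y' then s * y' else s.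

Definition principal (s : S) : {set S} :=
  [set t | [exists x, exists y, t == mul1r (mul1l x s) y]].

Definition J_class (s : S) : {set S} := [set t | principal t == principal s].

Definition regular_J_class (J : {set S}) :=
  [exists s, J == J_class s] && [exists f in J, f * f == f].

Record regJ := RegJ { jset :> {set S}; jsetP : regular_J_class jset }.

Definition Jnot (J : {set S}) : {set S} := [set s | ~~ (J \subset principal s)].

Record idem := Idem { ival :> S; ivalP : ival * ival = ival }.

Section MaximalSubgroup.
Variable e0 : idem.
Local Notation e := (ival e0).

Definition eSe : {set S} := [set e * s * e | s : S].

Definition maxgroup_set : {set S} :=
  [set g in eSe | [exists h in eSe, (g * h == e) && (h * g == e)]].

Record maxgroup := MaxGroup { gval :> S; gvalP : gval \in maxgroup_set }.

HB.instance Definition _ := [isSub for gval].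
HB.instance Definition _ := [Finite of maxgroup by <:].

Lemma eSe_e s : s \in eSe -> e * s = s /\ s * e = s.
Proof.
by case/imsetP=> t _ ->; rewrite -!mulgA !ivalP !mulgA !ivalP.
Qed.

Lemma eSe_M s t : s \in eSe -> t \in eSe -> s * t \in eSe.
Proof.
move=> /eSe_e[es _] /eSe_e[_ te]; apply/imsetP; exists (s * t) => //.
by rewrite !mulgA es -mulgA te.
Qed.

Fact maxgroup_e : e \in maxgroup_set.
Proof.
have ee : e \in eSe by apply/imsetP; exists e; rewrite ?ivalP.
by rewrite inE ee /=; apply/existsP; exists e; rewrite ee ivalP eqxx.
Qed.

Fact maxgroupM (g h : maxgroup) : gval g * gval h \in maxgroup_set.
Proof.
have := gvalP g; have := gvalP h.
rewrite !inE => /andP[hS /existsP[h' /and3P[h'S /eqP hh' /eqP h'h]]].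
move=> /andP[gS /existsP[g' /and3P[g'S /eqP gg' /eqP g'g]]].
rewrite eSe_M //=; apply/existsP; exists (h' * g'); rewrite eSe_M //=.
have [_ ge] := eSe_e gS; have [_ h'e] := eSe_e h'S.
rewrite -mulgA (mulgA (gval h)) hh' mulgA ge gg' eqxx /=.
by rewrite -mulgA (mulgA g') g'g mulgA h'e h'h.
Qed.

Definition maxgroup_mul (g h : maxgroup) := MaxGroup (maxgroupM g h).

Fact maxgroup_mulA : associative maxgroup_mul.
Proof. by move=> g h l; apply: val_inj; rewrite /= mulgA. Qed.

HB.instance Definition _ := isSemigroup.Build maxgroup maxgroup_mulA.

Definition maxgroup1 : maxgroup := MaxGroup maxgroup_e.

Lemma maxgroup1l (g : maxgroup) : maxgroup1 * g = g.
Proof.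
apply: val_inj => /=; have := gvalP g; rewrite inE => /andP[/eSe_e[]].
by [].
Qed.
Lemma maxgroup1r (g : maxgroup) : g * maxgroup1 = g.
Proof.
apply: val_inj => /=; have := gvalP g; rewrite inE => /andP[/eSe_e[]].
by [].
Qed.

End MaximalSubgroup.

Lemma principal_sub s t x y :
  t = mul1r (mul1l x s) y -> principal t \subset principal s.
Proof.
move=> ->; apply/subsetP=> u; rewrite !inE => /existsP[x' /existsP[y' /eqP->]].
apply/existsP; exists (if x' is Some a then Some (mul1r a x) else x).
apply/existsP; exists (if y' is Some b then Some (mul1l y b) else y).
by case: x x' y y' => [a|] [a'|] [b|] [b'|] /=; rewrite ?mulgA.
Qed.

Lemma Jnot_ideal (J : {set S}) s t : s \in Jnot J ->
  (t * s \in Jnot J) /\ (s * t \in Jnot J).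
Proof.
rewrite !inE => nJs; split; apply: contra nJs => /subset_trans; apply.
- exact: (@principal_sub s (t * s) (Some t) None).
- exact: (@principal_sub s (s * t) None (Some t)).
Qed.

End Green.

Section SemigroupAlgebra.
Variables (k : comPzSemiRingType) (S : finSemigroupType).

Definition sgfun : lSemiModType k := {ffun S -> k^o}.

Definition sgdelta (s : S) : sgfun := [ffun t => (t == s)%:R].

Definition sgmul (f g : sgfun) : sgfun :=
  \sum_(s : S) \sum_(t : S) (f s * g t) *: sgdelta (s * t)%g.

Lemma sg_decomp (f : sgfun) : f = \sum_(s : S) f s *: sgdelta s.
Proof.
apply/ffunP=> t; rewrite sum_ffunE (bigD1 t) //= !ffunE eqxx [_ *: _]mulr1.
rewrite big1 ?addr0 // => s st; rewrite !ffunE eq_sym (negPf st).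
exact: mulr0.
Qed.

Fact sgmulDl : left_distributive sgmul +%R.
Proof.
move=> f g h; rewrite -big_split; apply: eq_bigr => s _.
rewrite -big_split; apply: eq_bigr => t _.
by rewrite ffunE mulrDl scalerDl.
Qed.
Fact sgmulDr : right_distributive sgmul +%R.
Proof.
move=> f g h; rewrite -big_split; apply: eq_bigr => s _.
rewrite -big_split; apply: eq_bigr => t _.
by rewrite ffunE mulrDr scalerDl.
Qed.
Fact sgmulZl c f g : sgmul (c *: f) g = c *: sgmul f g.
Proof.
rewrite scaler_sumr; apply: eq_bigr => s _.
rewrite scaler_sumr; apply: eq_bigr => t _.
by rewrite ffunE scalerA mulrA.
Qed.
Fact sgmulZr c f g : sgmul f (c *: g) = c *: sgmul f g.
Proof.
rewrite scaler_sumr; apply: eq_bigr => s _.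
rewrite scaler_sumr; apply: eq_bigr => t _.
by rewrite ffunE scalerA mulrCA.
Qed.

Lemma sgmul_delta s t : sgmul (sgdelta s) (sgdelta t) = sgdelta (s * t)%g.
Proof.
rewrite /sgmul (bigD1 s) //= (bigD1 t) //= !ffunE !eqxx mulr1 scale1r.
rewrite !big1 ?addr0 // => u ut.
  by rewrite ffunE (negPf ut) big1 // => v _; rewrite mul0r scale0r.
by rewrite ffunE (negPf ut) mulr0 scale0r.
Qed.

Lemma sgmul0l f : sgmul 0 f = 0.
Proof. by rewrite -[X in sgmul X f](scale0r (0 : sgfun)) sgmulZl scale0r. Qed.
Lemma sgmul0r f : sgmul f 0 = 0.
Proof. by rewrite -[X in sgmul f X](scale0r (0 : sgfun)) sgmulZr scale0r. Qed.

Lemma sg_ind (P : sgfun -> Prop) : P 0 ->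
  (forall f g, P f -> P g -> P (f + g)) -> (forall c s, P (c *: sgdelta s)) ->
  forall f, P f.
Proof. by move=> P0 PD PZ f; rewrite [f]sg_decomp; apply: big_ind. Qed.

Fact sgmulA : associative sgmul.
Proof.
move=> f g h; elim/sg_ind: f => [|f f' IH IH'|a s].
- by rewrite !sgmul0l.
- by rewrite !sgmulDl IH IH'.
elim/sg_ind: g => [|g g' IH IH'|b t].
- by rewrite sgmul0r !sgmul0l sgmul0r.
- by rewrite sgmulDl !sgmulDr IH IH' sgmulDl.
elim/sg_ind: h => [|h h' IH IH'|c u].
- by rewrite !sgmul0r.
- by rewrite !sgmulDr IH IH'.
rewrite !(sgmulZl, sgmulZr, sgmul_delta) mulgA !scalerA.
by congr (_ *: _); rewrite -[RHS]mulrA [RHS]mulrC.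
Qed.

Definition sgalg : algebra k :=
  Algebra sgmulA sgmulDl sgmulDr sgmulZl sgmulZr.

(* the linear combinations of elements of X, as the functions supported on X  *)
Definition sgspan_pred (X : {set S}) (f : sgalg) :=
  forall s, s \notin X -> f s = 0.

Section Span.
Variable X : {set S}.
Fact sgspan0 : sgspan_pred X 0.
Proof. by move=> s _; rewrite ffunE. Qed.
Fact sgspanD f g : sgspan_pred X f -> sgspan_pred X g -> sgspan_pred X (f + g).
Proof. by move=> fX gX s sX; rewrite ffunE fX // gX // addr0. Qed.
Fact sgspanZ c f : sgspan_pred X f -> sgspan_pred X (c *: f).
Proof. by move=> fX s sX; rewrite ffunE fX // scaler0. Qed.
Definition sgspan : ksub sgalg := KSub sgspan0 sgspanD sgspanZ.
End Span.

Variable J : {set S}.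

Fact kJnotMl (f g : sgalg) : sgspan (Jnot J) g -> sgspan (Jnot J) (amul f g).
Proof.
move=> gJ u uJ; rewrite /= sum_ffunE big1 // => s _.
rewrite sum_ffunE big1 // => t _; rewrite !ffunE.
have [e|_] := eqVneq u (s * t)%g; last by rewrite [_ *: _]mulr0.
case: (boolP (t \in Jnot J)) => [tJ|tJ].
  by case/negP: uJ; rewrite e; case: (Jnot_ideal s tJ).
by rewrite gJ // mulr0 scale0r.
Qed.
Fact kJnotMr (f g : sgalg) : sgspan (Jnot J) g -> sgspan (Jnot J) (amul g f).
Proof.
move=> gJ u uJ; rewrite /= sum_ffunE big1 // => s _.
rewrite sum_ffunE big1 // => t _; rewrite !ffunE.
have [e|_] := eqVneq u (s * t)%g; last by rewrite [_ *: _]mulr0.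
case: (boolP (s \in Jnot J)) => [sJ|sJ].
  by case/negP: uJ; rewrite e; case: (Jnot_ideal t sJ).
by rewrite gJ // mul0r scale0r.
Qed.

Definition kJnot : ideal sgalg := Ideal kJnotMl kJnotMr.

Definition AJ : algebra k := aquot (ideal_cong kJnot).
Definition AJproj : alghom sgalg AJ := aproj (ideal_cong kJnot).
Definition AJproj_surj : forall b, exists a, AJproj a = b :=
  @aproj_surj _ _ (ideal_cong kJnot).

End SemigroupAlgebra.

Section MaximalSubgroupAlgebra.
Variables (k : comPzSemiRingType) (S : finSemigroupType) (e : idem S).
Local Notation kS := (sgalg k S).
Local Notation kG := (sgalg k (maxgroup e)).

Definition kG_incl (f : kG) : kS := \sum_(g : maxgroup e) f g *: sgdelta k (gval g).

Fact kG_incl_linear : semilinear kG_incl.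
Proof.
split=> [c f|f g] /=.
  by rewrite scaler_sumr; apply: eq_bigr => x _; rewrite ffunE scalerA.
by rewrite -big_split; apply: eq_bigr => x _; rewrite ffunE scalerDl.
Qed.

Lemma kG_incl_delta g : kG_incl (sgdelta k g) = sgdelta k (gval g).
Proof.
rewrite /kG_incl (bigD1 g) //= ffunE eqxx scale1r big1 ?addr0 // => h hg.
by rewrite ffunE (negPf hg) scale0r.
Qed.

Fact kG_inclM f g : kG_incl (amul f g) = amul (kG_incl f) (kG_incl g).
Proof.
have inclD (x y : kG) : kG_incl (x + y) = kG_incl x + kG_incl y.
  by rewrite (snd kG_incl_linear).
have inclZ c (x : kG) : kG_incl (c *: x) = c *: kG_incl x.
  by rewrite (fst kG_incl_linear).
have incl0 : kG_incl 0 = 0 by rewrite -(scale0r (0 : kG)) inclZ scale0r.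
rewrite /=; elim/sg_ind: f => [|f f' IH IH'|a s].
- by rewrite sgmul0l incl0 sgmul0l.
- by rewrite sgmulDl !inclD IH IH' sgmulDl.
elim/sg_ind: g => [|g g' IH IH'|b t].
- by rewrite sgmul0r incl0 sgmul0r.
- by rewrite sgmulDr !inclD IH IH' sgmulDr.
rewrite !(sgmulZl, sgmulZr, inclZ, kG_incl_delta) !sgmul_delta.
by rewrite kG_incl_delta.
Qed.

Definition kG_kS : alghom kG kS := AlgHom kG_incl_linear kG_inclM.

Fact kG_unity : is_unity (sgdelta k (maxgroup1 e) : kG).
Proof.
move=> f; rewrite /=; elim/sg_ind: f => [|f g [f1 f2] [g1 g2]|c g].
- by rewrite sgmul0l sgmul0r.
- by rewrite sgmulDl sgmulDr f1 f2 g1 g2.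
by rewrite sgmulZl sgmulZr !sgmul_delta maxgroup1l maxgroup1r.
Qed.

Fact kG_kS1 : kG_kS (sgdelta k (maxgroup1 e)) = sgdelta k e.
Proof. by rewrite /= kG_incl_delta. Qed.

Definition kS_corner : corner kG kS := Corner kG_unity kG_kS1.

Variable J : {set S}.

Definition AJ_e : AJ k J := AJproj k J (sgdelta k e).

Fact kG_AJ_linear : semilinear (fun f : kG => AJproj k J (kG_kS f)).
Proof. by split=> [c f|f g]; rewrite ?linearZ ?raddfD. Qed.
Fact kG_AJM (f g : kG) : AJproj k J (kG_kS (amul f g)) =
  amul (AJproj k J (kG_kS f)) (AJproj k J (kG_kS g)).
Proof. by rewrite !ahomM. Qed.
Definition kG_AJ : alghom kG (AJ k J) := AlgHom kG_AJ_linear kG_AJM.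

Fact kG_AJ1 : kG_AJ (sgdelta k (maxgroup1 e)) = AJ_e.
Proof. by rewrite /= kG_incl_delta. Qed.

Definition AJ_corner : corner kG (AJ k J) := Corner kG_unity kG_AJ1.

End MaximalSubgroupAlgebra.

Section IndCoind.
Variables (k : comPzSemiRingType) (S : finSemigroupType).
Local Notation kS := (sgalg k S).

Definition Ann (M : rmodule kS) (s : S) := forall m : M, m ** sgdelta k s = 0.

Definition apex (M : rmodule kS) (J : regJ S) :=
  forall s, Ann M s <-> s \in Jnot J.

Variables (J : {set S}) (e : idem S).
Variable V : rmodule (sgalg k (maxgroup e)).
Local Notation A := (AJ k J).
Local Notation eJ := (AJ_e k e J).

Definition Ind_AJ : rmodule A := tensor V (eA (AJ_corner k e J)).
Definition Coind_AJ : rmodule A := hom_module (Ae (AJ_corner k e J)) V.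

Definition Ind : rmodule kS := inflation (@AJproj_surj k S J) Ind_AJ.
Definition Coind : rmodule kS := inflation (@AJproj_surj k S J) Coind_AJ.

(* Ind and Ind_AJ have the same underlying k-module, so the congruence N and   *)
(* the submodule K of Ind can be written with the action of A_J.               *)
Definition Nrel (u v : Ind_AJ) := forall a : A, u ** a ** eJ = v ** a ** eJ.

Fact Nrel_refl u : Nrel u u. Proof. by []. Qed.
Fact Nrel_sym u v : Nrel u v -> Nrel v u. Proof. by move=> uv a. Qed.
Fact Nrel_trans u v w : Nrel u v -> Nrel v w -> Nrel u w.
Proof. by move=> uv vw a; rewrite uv vw. Qed.
Fact NrelD u v u' v' : Nrel u v -> Nrel u' v' -> Nrel (u + u') (v + v').
Proof. by move=> uv u'v' a; rewrite !ractDl uv u'v'. Qed.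
Fact NrelZ c u v : Nrel u v -> Nrel (c *: u) (c *: v).
Proof. by move=> uv a; rewrite !ractZl uv. Qed.
Definition N_k : kcong Ind := KCong Nrel_refl Nrel_sym Nrel_trans NrelD NrelZ.
Fact N_act (u v : Ind) a : N_k u v -> N_k (u ** a) (v ** a).
Proof.
by move=> uv b; have := uv (amul (AJproj k J a) b); rewrite -!ractA.
Qed.
Definition Ncong : congruence Ind := Congruence N_act.

Definition Kpred (m : Ind_AJ) := forall a : A, m ** a ** eJ = 0.

Fact Kpred0 : Kpred 0. Proof. by move=> a; rewrite !ract0l. Qed.
Fact KpredD u v : Kpred u -> Kpred v -> Kpred (u + v).
Proof. by move=> uK vK a; rewrite !ractDl uK vK addr0. Qed.
Fact KpredZ c u : Kpred u -> Kpred (c *: u).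
Proof. by move=> uK a; rewrite !ractZl uK scaler0. Qed.
Definition K_k : ksub Ind := KSub Kpred0 KpredD KpredZ.
Fact K_act (u : Ind) a : K_k u -> K_k (u ** a).
Proof.
by move=> uK b; have := uK (amul (AJproj k J a) b); rewrite -!ractA.
Qed.
Definition Ksub : submodule Ind := Submodule K_act.

Definition Coind_e_kS : submodule Coind :=
  xspan (fun phi => exists psi : Coind, phi = psi ** sgdelta k e).

End IndCoind.

(* Main.v *)
Require Import Defs.
From mathcomp Require Import all_boot ssralg.
From mathcomp Require Import boolp.

Set Implicit Arguments.
Unset Strict Implicit.
Unset Printing Implicit Defensive.

Import GRing.Theory.
Local Open Scope ring_scope.

(** Write A = kS, e = e_J and G = G_J.  For every A-module M, the part Me is a
module over kG, and the theorem says how much of M is recovered from Me.  Two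
objects measure the loss: the congruence [e_cong] that identifies u and v when
uae = vae for all a, and the submodule [e_kernel] of those u with uae = 0 for
all a.

Going down.  If J is the apex of M, then an element ese of eSe either lies in
G or annihilates M, because an element of eSe whose two-sided ideal contains e
is a unit of the finite monoid eSe ([eSe_unit]).  So eae acts on M as an element
of kG ([e_factors]), and a submodule or a congruence of Me extends to M by
testing all the translates xae.  Hence minimality and simplicity pass from M to
Me ([minimal_Me], [simple_Me]).

Going up.  Suppose that Me generates M.  A submodule W meets Me in a submodule
of Me; if Me is minimal, either W contains Me and is everything, or We = 0 and
W lies in [e_kernel] ([submod_dichotomy]).  A proper congruence restricts to
Me; if Me is simple, the restriction is trivial, as otherwise the class of 0
would be a submodule containing Me, and so the congruence lies in [e_cong]
([cong_e_cong]).  Thus [e_cong] and [e_kernel] are the largest proper congruence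
and submodule, and M is irreducible once Me is irreducible and [e_cong] is
trivial ([irreducible_of_Me]).

Induction and coinduction supply the modules.  Both have V as their part at e,
since e A_J e is kG.  Ind(V) is generated by that part and maps onto every
module that is annihilated by J^{not up}, is generated by its part at e, and
has that part isomorphic to V ([ind_onto]).  The kernel of such a map lies in [e_cong],
and equals it when the target is simple; this gives the uniqueness of the
irreducible module over V, and the list of the minimal ones.  In Coind(V)
the congruence [e_cong] is trivial, because a homomorphism f on A_J e is
determined by the values f(ae) = (fae)(e); so the submodule generated by the
part at e is irreducible and lies in every nonzero submodule.

Finally, every minimal kS-module has an apex ([minimal_apex]): take s outside
the annihilator with a smallest two-sided ideal.  Minimality of the module
shows that, for t outside the annihilator, some ut with u in the ideal of s is
outside it too; so s lies in the ideal of t.  Taking t = s produces an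
idempotent in the J-class of s.  The irreducible modules are thus
sorted by their apexes, and each apex contributes the irreducible
kG_J-modules. *)

(** * Homomorphisms, isomorphisms and quotients *)

Section Homs.
Variables (k : comPzSemiRingType) (A : algebra k).
Implicit Types M N P : rmodule A.

Definition surj (T U : Type) (f : T -> U) := forall y, exists x, f x = y.

(** The first isomorphism theorem in a symmetric form: two images of the same
module with the same kernel congruence are isomorphic.  Every isomorphism of
modules below is obtained from it. *)
Lemma riso_of_surj P M N (f : rhom P M) (g : rhom P N) :
  surj f -> surj g -> (forall x y, f x = f y <-> g x = g y) -> M ~= N.
Proof.
move=> fS gS fg.
pose s m := sval (cid (fS m)); pose t n := sval (cid (gS n)).
have sK m : f (s m) = m by rewrite /s; case: cid.
have tK n : g (t n) = n by rewrite /t; case: cid.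
have gsE x : g (s (f x)) = g x by apply/fg; rewrite sK.
have ftE x : f (t (g x)) = f x by apply/fg; rewrite tK.
have hlin : semilinear (fun m => g (s m)).
  split=> [d m|m m'].
  - by rewrite -{1}(sK m) -linearZ gsE linearZ.
  - by rewrite -{1}(sK m) -{1}(sK m') -raddfD gsE raddfD.
have hact m a : g (s (m ** a)) = g (s m) ** a.
  by rewrite -{1}(sK m) -rhom_act gsE rhom_act.
exists (RHom hlin hact); exists (fun n => f (t n)) => x /=.
- by rewrite ftE sK.
- by rewrite gsE tK.
Qed.

Fact rid_linear M : semilinear (fun m : M => m). Proof. by []. Qed.
Definition rid M : rhom M M := RHom (@rid_linear M) (fun m a => erefl).

Lemma riso_bij M N (f : rhom M N) : injective f -> surj f -> M ~= N.
Proof.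
move=> fi fS; apply: (@riso_of_surj M _ _ (rid M) f) => //.
  by move=> y; exists y.
by move=> x y; split=> [/= ->|/fi].
Qed.

Lemma risoP M N : M ~= N -> exists f : rhom M N, injective f /\ surj f.
Proof.
by case=> f [g fK gK]; exists f; split; [apply: can_inj fK | move=> y; exists (g y)].
Qed.

Lemma riso_refl M : M ~= M.
Proof. by exists (rid M); exists id. Qed.

Lemma riso_sym M N : M ~= N -> N ~= M.
Proof.
case/risoP=> f [fi fS]; apply: (@riso_of_surj M _ _ f (rid M)) => //.
  by move=> y; exists y.
by move=> x y; split=> [/fi|/= ->].
Qed.

Fact rcomp_linear M N P (f : rhom M N) (g : rhom N P) :
  semilinear (fun m => g (f m)).
Proof. by split=> [d m|m m']; rewrite ?linearZ ?raddfD. Qed.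
Fact rcomp_act M N P (f : rhom M N) (g : rhom N P) m a :
  g (f (m ** a)) = g (f m) ** a.
Proof. by rewrite !rhom_act. Qed.
Definition rcomp M N P (f : rhom M N) (g : rhom N P) : rhom M P :=
  RHom (rcomp_linear f g) (rcomp_act f g).

Lemma riso_trans M N P : M ~= N -> N ~= P -> M ~= P.
Proof.
case/risoP=> f [fi fS] /risoP[g [gi gS]]; apply: (@riso_bij _ _ (rcomp f g)).
  by move=> x y /gi/fi.
by move=> z; have [y <-] := gS z; have [x <-] := fS y; exists x.
Qed.

Definition rpi M (R : congruence M) : rhom M (rquot R) :=
  @RHom _ _ M (rquot R) (kpi R) (pair (@kpiZ _ _ R) (@kpiD _ _ R))
    (fun m a => esym (rquot_actE R m a)).

Lemma rpi_surj M (R : congruence M) : surj (rpi R).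
Proof. exact: kpi_surj. Qed.

Lemma rpiP M (R : congruence M) x y : rpi R x = rpi R y <-> R x y.
Proof. exact: kpiP. Qed.

Definition rincl M (W : submodule M) : rhom (rsub W) M :=
  @RHom _ _ (rsub W) M (@ksval _ _ W)
    (pair (fun c x => erefl) (fun x y => erefl)) (fun m a => erefl).

Lemma rincl_inj M (W : submodule M) : injective (rincl W).
Proof. exact: ksval_inj. Qed.

Lemma rinclP M (W : submodule M) x : W x <-> exists y, rincl W y = x.
Proof.
by split=> [Wx|[y <-]]; [exists (ksub_in Wx) | apply: ksub_valP].
Qed.

Section Pullback.
Variables (M N : rmodule A) (f : rhom M N).

Definition submod_preim (W : submodule N) : submodule M.
Proof.
unshelve refine (@Submodule _ _ M (@KSub _ M (fun x => W (f x)) _ _ _) _) => /=.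
- by rewrite raddf0; apply: ksub0.
- by move=> x y Wx Wy; rewrite raddfD; apply: ksubD.
- by move=> c x Wx; rewrite linearZ; apply: ksubZ.
- by move=> x a Wx; rewrite rhom_act; apply: submod_act.
Defined.

Definition submod_im (W : submodule M) : submodule N.
Proof.
unshelve refine (@Submodule _ _ N
  (@KSub _ N (fun y => exists2 x, W x & f x = y) _ _ _) _) => /=.
- by exists 0; [apply: ksub0 | rewrite raddf0].
- move=> _ _ [x Wx <-] [y Wy <-]; exists (x + y); last by rewrite raddfD.
  exact: ksubD.
- by move=> c _ [x Wx <-]; exists (c *: x); [apply: ksubZ | rewrite linearZ].
- move=> _ a [x Wx <-]; exists (x ** a); last by rewrite rhom_act.
  exact: submod_act.
Defined.

Definition cong_preim (R : congruence N) : congruence M.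
Proof.
unshelve refine (@Congruence _ _ M (@KCong _ M (fun x y => R (f x) (f y)) _ _ _ _ _) _).
- by move=> x; apply: krefl.
- by move=> x y; apply: ksym.
- by move=> x y z; apply: ktrans.
- by move=> x y x' y' Rx Ry; rewrite !raddfD; apply: kcongD.
- by move=> c x y Rx; rewrite !linearZ; apply: kcongZ.
- by move=> x y a Rx; rewrite /= !rhom_act; apply: cong_act.
Defined.

End Pullback.

Definition eq_cong M : congruence M.
Proof.
unshelve refine (@Congruence _ _ M (@KCong _ M eq _ _ _ _ _) _) => //.
- by move=> x y z -> ->.
- by move=> x y x' y' -> ->.
- by move=> c x y ->.
- by move=> x y a /= ->.
Defined.

Definition ker_cong M N (f : rhom M N) := cong_preim f (eq_cong N).

Definition full_submod M : submodule M.
Proof.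
by unshelve refine (@Submodule _ _ M (@KSub _ M (fun=> True) _ _ _) _).
Defined.

Lemma minimal_iso M N : M ~= N -> minimal M -> minimal N.
Proof.
case/risoP=> f [fi fS] [[m [a ma0]] minM]; split.
  exists (f m), a; rewrite -rhom_act => fma; apply: ma0; apply: fi.
  by rewrite fma raddf0.
move=> W; have [W0|W1] := minM (submod_preim f W); [left|right] => y.
  by have [x <-] := fS y => /W0->; rewrite raddf0.
by have [x <-] := fS y; apply: W1.
Qed.

Lemma simple_iso M N : M ~= N -> simple M -> simple N.
Proof.
case/risoP=> f [fi fS] [[m [a ma0]] simM]; split.
  exists (f m), a; rewrite -rhom_act => fma; apply: ma0; apply: fi.
  by rewrite fma raddf0.
move=> R [x [y nRxy]] x' y'.
have [u fu] := fS x; have [v fv] := fS y.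
have [u' <-] := fS x'; have [v' <-] := fS y' => Ruv'; congr (f _).
by apply: (simM (cong_preim f R)) Ruv'; exists u, v; rewrite /= fu fv.
Qed.

Lemma irreducible_iso M N : M ~= N -> irreducible M -> irreducible N.
Proof.
by move=> MN [sM mM]; split; [apply: simple_iso sM|apply: minimal_iso mM].
Qed.

End Homs.

(** * Corners: passing between a module and its part Me *)

Section Corner.
Variables (k : comPzSemiRingType) (B A : algebra k) (c : corner B A).
Local Notation e := (ce c).
Implicit Types M N : rmodule A.

Lemma actee M (m : M) : m ** e ** e = m ** e.
Proof. by rewrite ractA cee. Qed.

Lemma act_eb M (m : M) b : m ** e ** (c b) = m ** (c b).
Proof. by rewrite ractA ceM. Qed.

Definition me_val M (x : Me c M) : M := ksval (x : ksub_mod (Me_k c M)).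

Definition me_in M (m : M) : Me c M :=
  ksub_in (ex_intro (fun n => m ** e = n ** e) m erefl : Me_k c M (m ** e)).

Arguments me_val : simpl never.
Arguments me_in : simpl never.

Lemma me_inK M (m : M) : me_val (me_in m) = m ** e. Proof. by []. Qed.
Lemma me_val_inj M : injective (@me_val M). Proof. exact: ksval_inj. Qed.
Lemma me_val_e M (x : Me c M) : me_val x ** e = me_val x.
Proof. by rewrite /me_val; have [m ->] := ksub_valP x; rewrite actee. Qed.
Lemma me_valK M (x : Me c M) : me_in (me_val x) = x.
Proof. by apply: me_val_inj; rewrite me_inK me_val_e. Qed.
Lemma me_valD M (x y : Me c M) : me_val (x + y) = me_val x + me_val y.
Proof. by []. Qed.
Lemma me_valZ M d (x : Me c M) : me_val (d *: x) = d *: me_val x.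
Proof. by []. Qed.
Lemma me_val_act M (x : Me c M) b : me_val (x ** b) = me_val x ** c b.
Proof. by []. Qed.
Lemma me_in0 M : me_in (0 : M) = 0.
Proof. by apply: me_val_inj; rewrite me_inK ract0l. Qed.
Lemma me_inD M (m n : M) : me_in (m + n) = me_in m + me_in n.
Proof. by apply: me_val_inj; rewrite me_inK ractDl. Qed.
Lemma me_inZ M d (m : M) : me_in (d *: m) = d *: me_in m.
Proof. by apply: me_val_inj; rewrite me_inK ractZl. Qed.

Section Hom.
Variables (M N : rmodule A) (f : rhom M N).

Definition me_hom : rhom (Me c M) (Me c N).
Proof.
refine (@RHom _ _ (Me c M) (Me c N) (fun x => me_in (f (me_val x))) _ _).
- split=> [d x|x y].
  + by rewrite me_valZ linearZ me_inZ.
  + by rewrite me_valD raddfD me_inD.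
- move=> x b; apply: me_val_inj.
  by rewrite [RHS]me_val_act !me_inK act_eb me_val_act rhom_act ractA Mce.
Defined.

Lemma me_hom_val x : me_val (me_hom x) = f (me_val x).
Proof. by rewrite -[LHS]/(me_val (me_in _)) me_inK -rhom_act me_val_e. Qed.

End Hom.

Lemma Me_iso M N : M ~= N -> Me c M ~= Me c N.
Proof.
case/risoP=> f [fi fS]; apply: (@riso_bij _ _ _ _ (me_hom f)).
  by move=> x y /(congr1 (@me_val N)); rewrite !me_hom_val => /fi/me_val_inj.
move=> y; have [x fx] := fS (me_val y); exists (me_in x); apply: me_val_inj.
by rewrite me_hom_val me_inK rhom_act fx me_val_e.
Qed.

(** This is the condition that Me be nonzero, see [supported_Me]. *)
Definition supported M := exists m : M, m ** e <> 0.

Lemma nonzero_action_Me M : nonzero_action (Me c M) -> supported M.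
Proof.
case=> x [b xb0]; exists (me_val (x ** b)); rewrite me_val_e => h; apply: xb0.
exact: me_val_inj.
Qed.

Lemma supported_Me M : supported M -> nonzero_action (Me c M).
Proof.
case=> m me0; exists (me_in m), (cone c) => /(congr1 (@me_val M)).
by rewrite me_val_act me_inK cmap1 actee.
Qed.

Lemma supported_act M : supported M -> nonzero_action M.
Proof. by case=> m me0; exists m, e. Qed.

(** [e_kernel] is the largest submodule W with We = 0, and [e_cong] the largest
congruence that is trivial on Me. *)
Definition e_kernel M : submodule M.
Proof.
unshelve refine (@Submodule _ _ M
  (@KSub _ M (fun x => forall a, x ** a ** e = 0) _ _ _) _) => /=.
- by move=> a; rewrite !ract0l.
- by move=> x y x0 y0 a; rewrite !ractDl x0 y0 addr0.
- by move=> d x x0 a; rewrite !ractZl x0 scaler0.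
- by move=> x a x0 b; rewrite (ractA x).
Defined.

Definition e_cong M : congruence M.
Proof.
unshelve refine (@Congruence _ _ M
  (@KCong _ M (fun x y => forall a, x ** a ** e = y ** a ** e) _ _ _ _ _) _).
- by [].
- by move=> x y xy a.
- by move=> x y z xy yz a; rewrite xy.
- by move=> x y x' y' xy x'y' a; rewrite !ractDl xy x'y'.
- by move=> d x y xy a; rewrite !ractZl xy.
- by move=> x y a xy b; rewrite /= !(ractA _ a).
Defined.

Lemma minimal_e_kernel M (x : M) :
  minimal M -> supported M -> e_kernel M x -> x = 0.
Proof.
case=> _ minM [m me0]; have [h|h] := minM (e_kernel M); first exact: h.
by case: me0; rewrite -actee h.
Qed.

Lemma simple_e_cong M (x y : M) :
  simple M -> supported M -> e_cong M x y -> x = y.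
Proof.
case=> _ simM [m me0]; apply: simM; exists m, 0 => /(_ e).
by rewrite actee !ract0l.
Qed.

(** M is generated by Me; stated by the property of submodules that is used, to
avoid sums. *)
Definition e_generated M :=
  forall W : submodule M, (forall m, W (m ** e)) -> submod_full W.

Lemma minimal_e_generated M : minimal M -> supported M -> e_generated M.
Proof.
case=> _ minM [m me0] W We; have [W0|//] := minM W.
by case: me0; apply/W0/We.
Qed.

Lemma e_generated_surj M N (f : rhom M N) :
  surj f -> e_generated M -> e_generated N.
Proof.
move=> fS genM W We y; have [x <-] := fS y.
by apply: (genM (submod_preim f W)) => m; rewrite /= rhom_act.
Qed.

Definition me_submod M (W : submodule M) : submodule (Me c M).
Proof.
unshelve refine (@Submodule _ _ (Me c M)
  (@KSub _ (Me c M) (fun x => W (me_val x)) _ _ _) _).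
- exact: ksub0.
- by move=> x y; apply: ksubD.
- by move=> d x; apply: ksubZ.
- by move=> x b; apply: submod_act.
Defined.

Definition me_cong M (R : congruence M) : congruence (Me c M).
Proof.
unshelve refine (@Congruence _ _ (Me c M)
  (@KCong _ (Me c M) (fun x y => R (me_val x) (me_val y)) _ _ _ _ _) _).
- by move=> x; apply: krefl.
- by move=> x y; apply: ksym.
- by move=> x y z; apply: ktrans.
- by move=> x y x' y'; apply: kcongD.
- by move=> d x y; apply: kcongZ.
- by move=> x y b; apply: cong_act.
Defined.

(** Over a semiring a congruence is not determined by this submodule, so that
submodules and congruences have to be treated separately. *)
Definition zero_class M (R : congruence M) : submodule M.
Proof.
unshelve refine (@Submodule _ _ M (@KSub _ M (fun x => R x 0) _ _ _) _) => /=.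
- exact: krefl.
- by move=> s t Rs Rt; rewrite -[0]addr0; apply: kcongD.
- by move=> d s Rs; rewrite -(scaler0 M d); apply: kcongZ.
- by move=> s b Rs; rewrite -(ract0l M b); apply: cong_act.
Defined.

(** We is contained in W and is a submodule of the minimal module Me: either it
is Me, which generates M, or it is 0. *)
Lemma submod_dichotomy M (W : submodule M) :
  e_generated M -> minimal (Me c M) ->
  submod_full W \/ forall x, W x -> e_kernel M x.
Proof.
move=> genM [_ minMe]; have [h|h] := minMe (me_submod W); [right|left].
  move=> x Wx a; have Wxa : me_submod W (me_in (x ** a)).
    by do 2!apply: submod_act.
  by rewrite -me_inK (h _ Wxa).
by apply: genM => m; rewrite -me_inK; apply: h.
Qed.

(** The congruence R restricts to Me.  A trivial restriction identifies xae with
yae whenever R x y; a full one puts Me, hence M, into the class of 0. *)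
Lemma cong_e_cong M (R : congruence M) x y :
  e_generated M -> simple (Me c M) -> cong_proper R -> R x y -> e_cong M x y.
Proof.
move=> genM [_ simMe] [u [v nRuv]] Rxy a.
case: (EM (cong_proper (me_cong R))) => [Rp|nRp].
  rewrite -!me_inK; congr me_val; apply: simMe Rp _ _ _.
  by rewrite /= !me_inK; do 2!apply: cong_act.
have Re0 m : R (m ** e) 0.
  apply: contrapT => nR; apply: nRp; exists (me_in m), 0.
  by rewrite /= me_inK.
have W1 := genM (zero_class R) Re0.
by case: nRuv; apply: ktrans (W1 u) _; apply/ksym/W1.
Qed.

(** Converses of [minimal_Me] and [simple_Me]: no part of M may be invisible to
e. *)
Lemma minimal_of_Me M : e_generated M -> minimal (Me c M) ->
  (forall x, e_kernel M x -> x = 0) -> minimal M.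
Proof.
move=> genM minMe sepM; split.
  exact/supported_act/nonzero_action_Me/(proj1 minMe).
move=> W; have [|h] := submod_dichotomy W genM minMe; first by right.
by left=> x /h/sepM.
Qed.

Lemma irreducible_of_Me M : e_generated M -> irreducible (Me c M) ->
  (forall x y, e_cong M x y -> x = y) -> irreducible M.
Proof.
move=> genM [simMe minMe] sepM; split; last first.
  apply: minimal_of_Me => // x x0.
  by apply: sepM => a; rewrite !ract0l; apply: x0.
split; first exact/supported_act/nonzero_action_Me/(proj1 minMe).
by move=> R Rp x y /(cong_e_cong genM simMe Rp)/sepM.
Qed.

Lemma Me_rquot M (R : congruence M) :
  (forall x y, R x y -> e_cong M x y) -> Me c M ~= Me c (rquot R).
Proof.
move=> RN; apply: (@riso_bij _ _ _ _ (me_hom (rpi R))) => [x y|y].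
  move/(congr1 (@me_val _)); rewrite !me_hom_val => /rpiP/RN/(_ e).
  by rewrite !actee !me_val_e => /me_val_inj.
have [m pim] := rpi_surj (me_val y); exists (me_in m); apply: me_val_inj.
by rewrite me_hom_val me_inK rhom_act pim me_val_e.
Qed.

(** The element eae of A acts on M through B, although it need not come from B:
it may differ from an element of B by something that annihilates M. *)
Definition e_factors M :=
  forall a, exists b, forall m : M, m ** e ** a ** e = m ** c b.

(** The largest submodule and the largest congruence of M whose restrictions to
Me are contained in W and R.  That these restrictions are all of W and R is
where [e_factors] comes in. *)
Definition me_submod_lift M (W : submodule (Me c M)) : submodule M.
Proof.
unshelve refine (@Submodule _ _ M
  (@KSub _ M (fun x => forall a, W (me_in (x ** a))) _ _ _) _) => /=.
- by move=> a; rewrite ract0l me_in0; apply: ksub0.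
- by move=> x y Wx Wy a; rewrite ractDl me_inD; apply: ksubD.
- by move=> d x Wx a; rewrite ractZl me_inZ; apply: ksubZ.
- by move=> x a Wx b; rewrite ractA.
Defined.

Definition me_cong_lift M (R : congruence (Me c M)) : congruence M.
Proof.
unshelve refine (@Congruence _ _ M (@KCong _ M
  (fun x y => forall a, R (me_in (x ** a)) (me_in (y ** a))) _ _ _ _ _) _).
- by move=> z a; apply: krefl.
- by move=> z t h a; apply: ksym.
- by move=> z t r h h' a; apply: ktrans (h a) (h' a).
- by move=> z t z' t' h h' a; rewrite !ractDl !me_inD; apply: kcongD.
- by move=> d z t h a; rewrite !ractZl !me_inZ; apply: kcongZ.
- by move=> z t a h b; rewrite !ractA.
Defined.

Lemma minimal_Me M :
  e_factors M -> supported M -> minimal M -> minimal (Me c M).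
Proof.
move=> facM supM [_ minM]; split; first exact: supported_Me.
move=> W; have [h|h] := minM (me_submod_lift W); [left|right] => x.
  move=> Wx; apply: me_val_inj; apply: h => a /=.
  (* W is stable under eae, which acts on x as an element of B. *)
  have [b ab] := facM a; suff -> : me_in (me_val x ** a) = x ** b.
    exact: submod_act.
  by apply: me_val_inj; rewrite me_inK me_val_act -ab me_val_e.
by have := h (me_val x) e; rewrite /= me_val_e me_valK.
Qed.

Lemma simple_Me M : e_factors M -> supported M -> simple M -> simple (Me c M).
Proof.
move=> facM supM [_ simM]; split; first exact: supported_Me.
move=> R [u [v nRuv]] x y Rxy.
apply: me_val_inj; apply: (simM (me_cong_lift R)) => [|a].
  exists (me_val u), (me_val v) => /(_ e).
  by rewrite /= !me_val_e !me_valK.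
have [b ab] := facM a.
have E (z : Me c M) : me_in (me_val z ** a) = z ** b.
  by apply: me_val_inj; rewrite me_inK me_val_act -ab me_val_e.
by rewrite /= !E; apply: cong_act.
Qed.

End Corner.

Arguments me_val : simpl never.
Arguments me_in : simpl never.
(** * Extremal congruences and submodules *)

Section Extremal.
Variables (k : comPzSemiRingType) (B A : algebra k) (c : corner B A).
Local Notation e := (ce c).
Variable M : rmodule A.

(** The congruence N is a parameter, known up to equivalence, because Ncong is
written with the action of A_J. *)
Lemma e_cong_unique_maximal (N : congruence M) :
  (forall x y, N x y <-> e_cong c M x y) ->
  e_generated c M -> simple (Me c M) -> unique_maximal_cong N.
Proof.
move=> NE genM simMe.
have maxN (R : congruence M) x y : cong_proper R -> R x y -> N x y.
  by move=> Rp Rxy; apply/NE; apply: cong_e_cong Rxy.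
have Np : cong_proper N.
  have [m me0] := nonzero_action_Me (proj1 simMe).
  by exists m, 0 => /NE/(_ e); rewrite actee !ract0l.
split; first by split=> // R Rp _ x y; apply: maxN.
move=> R [Rp Rmax] x y; split; first exact: maxN.
by apply: Rmax => // u v; apply: maxN.
Qed.

Lemma e_kernel_unique_maximal (K : submodule M) :
  (forall x, K x <-> e_kernel c M x) ->
  e_generated c M -> minimal (Me c M) -> unique_maximal_submod K.
Proof.
move=> KE genM minMe.
have maxK (W : submodule M) x : ~ submod_full W -> W x -> K x.
  move=> nW Wx; apply/KE; have [//|h] := submod_dichotomy W genM minMe.
  exact: h.
have Kp : ~ submod_full K.
  have [m me0] := nonzero_action_Me (proj1 minMe).
  by move=> /(_ m)/KE/(_ e); rewrite actee.
split; first by split=> // W Wp _ x; apply: maxK.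
move=> W [Wp Wmax] x; split; first exact: maxK.
by apply: Wmax => // u; apply: maxK.
Qed.

Definition e_span : submodule M := xspan (fun x => exists m : M, x = m ** e).

Lemma e_span_e m : e_span (m ** e).
Proof.
exists [:: (m ** e, e)]; split; last by rewrite big_seq1 actee.
by move=> p; rewrite inE => /eqP->; exists m.
Qed.

Lemma e_span_min (W : submodule M) x :
  (forall m, W (m ** e)) -> e_span x -> W x.
Proof.
move=> We [s [sX ->]]; elim: s sX => [|p s IH] sX.
  by rewrite big_nil; apply: ksub0.
rewrite big_cons; apply: ksubD.
  have [|m ->] := sX p; first by rewrite inE eqxx.
  exact/submod_act/We.
by apply: IH => q qs; apply: sX; rewrite inE qs orbT.
Qed.

Lemma Me_e_span : Me c (rsub e_span) ~= Me c M.
Proof.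
apply: (@riso_bij _ _ _ _ (me_hom c (rincl e_span))) => [x y|y].
  by move/(congr1 (@me_val _ _ _ _ _)); rewrite !me_hom_val => /rincl_inj/me_val_inj.
have /rinclP[x xy] := e_span_e (me_val y).
exists (me_in c x); apply: me_val_inj.
by rewrite me_hom_val me_inK rhom_act xy !me_val_e.
Qed.

Lemma e_span_generated : e_generated c (rsub e_span).
Proof.
move=> W We x.
have : submod_im (rincl e_span) W (rincl e_span x).
  apply: e_span_min; last by apply/rinclP; exists x.
  move=> m; have /rinclP[y ym] := e_span_e m.
  by exists (y ** e); [apply: We | rewrite rhom_act ym actee].
by case=> y Wy /rincl_inj <-.
Qed.

(** A nonzero submodule W has xae nonzero for some x in W; so it meets the minimal
module Me, contains it, and contains what it generates. *)
Lemma e_span_unique_minimal :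
  (forall x, e_kernel c M x -> x = 0) -> minimal (Me c M) ->
  unique_minimal_submod e_span.
Proof.
move=> sepM minMe.
have minE (W : submodule M) x : ~ submod_zero W -> e_span x -> W x.
  move=> nW; apply: e_span_min => m; rewrite -me_inK.
  have [h|] := (proj2 minMe) (me_submod c W); last by apply.
  case: nW => y Wy; apply: sepM => a.
  have Wya : me_submod c W (me_in c (y ** a)) by do 2!apply: submod_act.
  by rewrite -me_inK (h _ Wya).
have nE : ~ submod_zero e_span.
  have [m me0] := nonzero_action_Me (proj1 minMe).
  by move=> E0; apply/me0/E0/e_span_e.
split; first by split=> // W nW _ x; apply: minE.
move=> W [nW Wmin] x; split; last exact: minE.
by apply: Wmin => // y; apply: minE.
Qed.

Lemma e_span_irreducible :
  (forall x y, e_cong c M x y -> x = y) -> irreducible (Me c M) ->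
  irreducible (rsub e_span).
Proof.
move=> sepM irrM; apply: (irreducible_of_Me e_span_generated).
  exact: irreducible_iso (riso_sym Me_e_span) irrM.
move=> x y xy; apply: rincl_inj; apply: sepM => a.
by have := congr1 (rincl e_span) (xy a); rewrite !rhom_act.
Qed.

End Extremal.

(** * Induction and coinduction through a full corner *)

Section TensorLift.
Variables (k : comPzSemiRingType) (B A : algebra k).
Variables (V : rmodule B) (X : bimodule B A) (N : lSemiModType k).
Variable beta : V -> X -> N.
Hypothesis betaDl : forall v w x, beta (v + w) x = beta v x + beta w x.
Hypothesis betaDr : forall v x y, beta v (x + y) = beta v x + beta v y.
Hypothesis betaZl : forall d v x, beta (d *: v) x = d *: beta v x.
Hypothesis betaZr : forall d v x, beta v (d *: x) = d *: beta v x.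
Hypothesis betaB : forall v b x, beta (v ** b) x = beta v (blact b x).

Definition word_sum (s : seq (V * X)) : N := \sum_(p <- s) beta p.1 p.2.

(** The universal property of the tensor product, checked on words. *)
Lemma word_sum_rel s t : tens_rel s t -> word_sum s = word_sum t.
Proof.
rewrite /word_sum; elim=> {s t} => [||s r t _ -> _ ->||||||||] //.
- by move=> s t s' t' _ st _ s't'; rewrite !big_cat /= st s't'.
- by move=> s t; rewrite !big_cat /= addrC.
- by move=> v v' x; rewrite big_seq1 big_cons big_seq1 /= betaDl.
- by move=> v x x'; rewrite big_seq1 big_cons big_seq1 /= betaDr.
- by move=> x; rewrite big_seq1 big_nil /= -(scale0r (0 : V)) betaZl scale0r.
- by move=> v; rewrite big_seq1 big_nil /= -(scale0r (0 : X)) betaZr scale0r.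
- by move=> d v x; rewrite !big_seq1 /= betaZl betaZr.
- by move=> v b x; rewrite !big_seq1 /= betaB.
Qed.

Definition tens_lift (u : tensor V X) : N := word_sum (repr (u : tens V X)).

Lemma tens_liftE s : tens_lift (tpi s) = word_sum s.
Proof. exact/word_sum_rel/repr_tpi. Qed.

Lemma tens_lift_linear : semilinear tens_lift.
Proof.
split=> [d u|u v].
  have [s <-] := tpi_surj u.
  rewrite -[d *: _]/(tens_scl d (tpi s)) tens_sclE !tens_liftE /word_sum.
  by rewrite big_map scaler_sumr; apply: eq_bigr => p _ /=.
have [s <-] := tpi_surj u; have [t <-] := tpi_surj v.
by rewrite -[_ + _]/((tpi s : tens V X) + tpi t) -tpiD !tens_liftE /word_sum big_cat.
Qed.

End TensorLift.

Definition pure (k : comPzSemiRingType) (B A : algebra k) (V : rmodule B)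
  (X : bimodule B A) (v : V) (x : X) : tensor V X := tpi [:: (v, x)].

Lemma tens_ind (k : comPzSemiRingType) (B A : algebra k) (V : rmodule B)
    (X : bimodule B A) (P : tensor V X -> Prop) :
  P 0 -> (forall u v, P u -> P v -> P (u + v)) ->
  (forall v x, P (pure v x)) -> forall u, P u.
Proof.
move=> P0 PD Pe u; have [s <-] := tpi_surj u; elim: s => [|[v x] s IH] //.
by rewrite -cat1s tpiD; apply: PD IH; apply: Pe.
Qed.

(** The situation common to kS, A_J and kG_J: A' is a quotient of A, and B is
identified by c' with the whole corner e'A'e' of A'. *)
Section FullCorner.
Variables (k : comPzSemiRingType) (B A A' : algebra k).
Variables (pi : alghom A A') (piS : forall b, exists a, pi a = b).
Variables (c : corner B A) (c' : corner B A').
Local Notation e := (ce c).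
Local Notation e' := (ce c').
Hypothesis c'E : forall b, c' b = pi (c b).
Hypothesis c'_inj : injective c'.
Hypothesis c'_full : forall a, exists b, c' b = amul (amul e' a) e'.

Lemma pi_e : pi e = e'.
Proof. by rewrite -(cmap1 c) -c'E cmap_unity //; apply: cone_unity. Qed.

(** The map a |-> e'ae', read in B.  It is B-linear on both sides, and carries
both identifications of V with the part at e of an induced or coinduced
module. *)
Definition theta (a : A') : B := sval (cid (c'_full a)).

Lemma c'_theta a : c' (theta a) = amul (amul e' a) e'.
Proof. by rewrite /theta; case: cid. Qed.

Lemma thetaD a b : theta (a + b) = theta a + theta b.
Proof. by apply: c'_inj; rewrite raddfD /= !c'_theta amulDr amulDl. Qed.
Lemma thetaZ d a : theta (d *: a) = d *: theta a.
Proof. by apply: c'_inj; rewrite linearZ /= !c'_theta amulZr amulZl. Qed.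
Lemma theta_cl b a : theta (amul (c' b) a) = amul b (theta a).
Proof.
by apply: c'_inj; rewrite ahomM !c'_theta !amulA ceM Mce.
Qed.
Lemma theta_cr a b : theta (amul a (c' b)) = amul (theta a) b.
Proof.
by apply: c'_inj; rewrite ahomM !c'_theta -!amulA ceM Mce.
Qed.
Lemma theta_e : theta e' = cone c'.
Proof. by apply: c'_inj; rewrite c'_theta !cee cmap1. Qed.

(** M is a module over A' through pi.  It is kept as a module over A, since the
identity axiom for a module over A' could fail if A' has an identity and A has
none. *)
Definition factors (M : rmodule A) :=
  forall a b, pi a = pi b -> forall m : M, m ** a = m ** b.

Lemma factors_e_factors M : factors M -> e_factors c M.
Proof.
move=> facM a; exists (theta (pi a)) => m; rewrite !ractA; apply: facM.
by rewrite -c'E c'_theta !ahomM pi_e amulA.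
Qed.

Lemma factors_surj M N (f : rhom M N) : surj f -> factors M -> factors N.
Proof.
by move=> fS facM a b ab n; have [m <-] := fS n; rewrite -!rhom_act (facM a b).
Qed.

Lemma factors_inj M N (f : rhom M N) : injective f -> factors N -> factors M.
Proof. by move=> fi facN a b ab m; apply: fi; rewrite !rhom_act (facN a b). Qed.

Lemma factors_inflation (M : rmodule A') : factors (inflation piS M).
Proof. by move=> a b ab m; rewrite /= /infl_act ab. Qed.

Variable V : rmodule B.

(** ** Induction *)

Definition ind : rmodule A := inflation piS (tensor V (eA c')).

Definition e_eA : eA c' := ksub_in (ex_intro _ e' (esym (cee c')) : eA_k c' e').

Definition ind_unit (v : V) : ind := pure v e_eA.

(** v (x) x |-> v theta(x), the inverse of [ind_unit] on the part at e. *)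
Definition ind_counit : ind -> V :=
  tens_lift (fun v (x : eA c') => v ** theta (ksval x)).

Lemma ind_actE v (x : eA c') a :
  (pure v x : ind) ** a = pure v (bract x (pi a)).
Proof. by rewrite /= /infl_act [LHS]tens_actE. Qed.

Lemma ind_counitE v (x : eA c') : ind_counit (pure v x) = v ** theta (ksval x).
Proof.
rewrite [LHS]tens_liftE /word_sum ?big_seq1 //=.
- by move=> *; rewrite ractDl.
- by move=> *; rewrite thetaD ractDr.
- by move=> *; rewrite ractZl.
- by move=> *; rewrite thetaZ ractZr.
- by move=> *; rewrite theta_cl ractA.
Qed.

Lemma ind_counit_linear : semilinear ind_counit.
Proof.
apply: tens_lift_linear => *.
- by rewrite ractDl.
- by rewrite /= thetaD ractDr.
- by rewrite ractZl.
- by rewrite /= thetaZ ractZr.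
- by rewrite /= theta_cl ractA.
Qed.

Lemma ind_unitK v : ind_counit (ind_unit v) = v.
Proof. by rewrite ind_counitE /= theta_e (ract1 (cone_unity c')). Qed.

Lemma ind_unitD v w : ind_unit (v + w) = ind_unit v + ind_unit w.
Proof. by rewrite -[RHS]tpiD; apply/tpiP/tens_addl. Qed.

Lemma ind_unitZ d v : ind_unit (d *: v) = d *: ind_unit v.
Proof.
by rewrite -[RHS]/(tens_scl d (tpi _)) tens_sclE; apply/tpiP/tens_scale.
Qed.

Lemma ind_unit_act v b : ind_unit (v ** b) = ind_unit v ** c b.
Proof.
rewrite ind_actE; apply/tpiP; apply: tens_trans (tens_bal _ _ _) _.
set x := blact _ _; set y := bract _ _.
have -> : x = y; last exact: tens_refl.
by apply: ksval_inj; rewrite /= -c'E Mce ceM.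
Qed.

Lemma ind_unit_e v : ind_unit v ** e = ind_unit v.
Proof. by rewrite -cmap1 -ind_unit_act (ract1 (cone_unity c)). Qed.

(** (v (x) x)e = v (x) e'xe' = v theta(x) (x) e', as x lies in e'A'. *)
Lemma ind_e m : m ** e = ind_unit (ind_counit m).
Proof.
elim/tens_ind: m => [|u v IHu IHv|v x].
- rewrite ract0l -(scale0r (0 : ind)) (fst ind_counit_linear).
  by rewrite ind_unitZ !scale0r.
- by rewrite ractDl IHu IHv (snd ind_counit_linear) ind_unitD.
rewrite ind_actE ind_counitE ind_unit_act ind_actE; congr pure.
apply: ksval_inj; rewrite /= -c'E c'_theta pi_e !amulA cee.
by rewrite (eA_e (ksub_valP x)).
Qed.

Definition ind_unit_hom : rhom V (Me c ind).
Proof.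
unshelve refine (@RHom _ _ V (Me c ind) (fun v => me_in c (ind_unit v)) _ _).
- by split=> [d v|v w]; rewrite ?ind_unitZ ?ind_unitD ?me_inZ ?me_inD.
- move=> v b; apply: me_val_inj.
  by rewrite me_val_act !me_inK !ind_unit_e ind_unit_act.
Defined.

Lemma ind_Me : V ~= Me c ind.
Proof.
exists ind_unit_hom; exists (fun x : Me c ind => ind_counit (me_val x)) => [v|x] /=.
  by rewrite me_inK ind_unit_e ind_unitK.
by apply: (@me_val_inj _ _ _ c ind); rewrite me_inK -ind_e !me_val_e.
Qed.

Lemma ind_generated : e_generated c ind.
Proof.
move=> W We u; elim/tens_ind: u => [|u v IHu IHv|v x].
- exact: ksub0.
- exact: ksubD.
have [a pa] := piS (ksval x).
have -> : pure v x = ind_unit v ** a.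
  rewrite ind_actE; congr pure; apply: ksval_inj.
  by rewrite /= pa (eA_e (ksub_valP x)).
by apply: submod_act; rewrite -ind_unit_e; apply: We.
Qed.

(** The adjunction between induction and M |-> Me: v (x) x is sent to phi(v)x,
where x acts on M through any of its preimages in A. *)
Lemma ind_hom (M : rmodule A) (phi : rhom V (Me c M)) : factors M ->
  exists f : rhom ind M, forall v, f (ind_unit v) = me_val (phi v).
Proof.
move=> facM; pose s (a : A') := sval (cid (piS a)).
have sK a : pi (s a) = a by rewrite /s; case: cid.
pose beta v (x : eA c') : M := me_val (phi v) ** s (ksval x).
have bDl v w x : beta (v + w) x = beta v x + beta w x.
  by rewrite /beta raddfD me_valD ractDl.
have bDr v x y : beta v (x + y) = beta v x + beta v y.
  by rewrite /beta -ractDr; apply: facM; rewrite sK raddfD /= !sK.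
have bZl d v x : beta (d *: v) x = d *: beta v x.
  by rewrite /beta linearZ me_valZ ractZl.
have bZr d v x : beta v (d *: x) = d *: beta v x.
  by rewrite /beta -ractZr; apply: facM; rewrite sK linearZ /= !sK.
have bB v b x : beta (v ** b) x = beta v (blact b x).
  rewrite /beta rhom_act me_val_act ractA; apply: facM.
  by rewrite ahomM !sK -c'E.
have lin := tens_lift_linear bDl bDr bZl bZr bB.
have liftE := tens_liftE bDl bDr bZl bZr bB.
have act (u : ind) a : tens_lift beta (u ** a) = tens_lift beta u ** a.
  elim/tens_ind: u => [|u v IHu IHv|v x].
  - rewrite ract0l -(scale0r (0 : ind)) (fst lin) !scale0r.
    by rewrite ract0l.
  - by rewrite ractDl !(snd lin) IHu IHv ractDl.
  rewrite ind_actE !liftE /word_sum !big_seq1 /beta ractA; apply: facM.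
  by rewrite ahomM !sK.
exists (@RHom _ _ ind M _ lin act) => v; rewrite [LHS]liftE /word_sum big_seq1 /beta /=.
by rewrite -[RHS]me_val_e; apply: facM; rewrite sK pi_e.
Qed.

(** The map of [ind_hom] is injective on the part at e, because phi is; hence its
kernel is contained in [e_cong]. *)
Lemma ind_onto (M : rmodule A) :
  factors M -> e_generated c M -> V ~= Me c M ->
  exists f : rhom ind M, [/\ surj f,
    forall u v, f u = f v -> e_cong c ind u v &
    forall u v, e_cong c ind u v -> e_cong c M (f u) (f v)].
Proof.
move=> facM genM /risoP[phi [phi_inj phiS]]; have [f fE] := ind_hom phi facM.
exists f; split.
- move=> y; have := genM (submod_im f (full_submod ind)).
  move=> /(_ _ y)[m|x _ <-]; last by exists x.
  have [v vm] := phiS (me_in c m); exists (ind_unit v) => //.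
  by rewrite fE vm me_inK.
- move=> u v fuv a; rewrite !ind_e; congr ind_unit; apply: phi_inj.
  apply: me_val_inj; rewrite -!fE -!ind_e !rhom_act.
  by rewrite fuv.
- by move=> u v uv a; rewrite -!rhom_act uv.
Qed.

Lemma supported_iso M : nonzero_action V -> Me c M ~= V -> supported c M.
Proof.
case=> v [b vb0] /risoP[phi [phi_inj phiS]]; apply: nonzero_action_Me.
have [x xv] := phiS v; exists x, b => xb0; apply: vb0.
by rewrite -xv -rhom_act xb0 raddf0.
Qed.

(** For M simple, the map of [ind_onto] also sends [e_cong] into equality; so its
kernel is [e_cong], the same for M and N. *)
Lemma ind_irreducible_unique M N : irreducible V ->
  irreducible M -> factors M -> Me c M ~= V ->
  irreducible N -> factors N -> Me c N ~= V -> M ~= N.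
Proof.
move=> [[Vnz _] _] [simM minM] facM MV [simN minN] facN NV.
have supM := supported_iso Vnz MV; have supN := supported_iso Vnz NV.
have genM := minimal_e_generated minM supM.
have genN := minimal_e_generated minN supN.
have [f [fS fN Nf]] := ind_onto facM genM (riso_sym MV).
have [g [gS gN Ng]] := ind_onto facN genN (riso_sym NV).
apply: (riso_of_surj fS gS) => x y; split.
  by move=> /fN/Ng; apply: simple_e_cong.
by move=> /gN/Nf; apply: simple_e_cong.
Qed.

Lemma ind_quot_Me (R : congruence ind) :
  (forall u v, R u v -> e_cong c ind u v) -> Me c (rquot R) ~= V.
Proof. by move=> RN; apply/riso_sym/(riso_trans ind_Me)/Me_rquot. Qed.

Lemma ind_quot_factors (R : congruence ind) : factors (rquot R).
Proof. by apply: factors_surj (@rpi_surj _ _ _ R) _; apply: factors_inflation. Qed.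

Lemma ind_quot_generated (R : congruence ind) : e_generated c (rquot R).
Proof. exact: e_generated_surj (@rpi_surj _ _ _ R) ind_generated. Qed.

Lemma ind_quot_irreducible (N : congruence ind) :
  (forall u v, N u v <-> e_cong c ind u v) -> irreducible V ->
  irreducible (rquot N).
Proof.
move=> NE irrV; apply: (irreducible_of_Me (@ind_quot_generated N)).
  by apply: irreducible_iso irrV; apply/riso_sym/ind_quot_Me => u v /NE.
move=> x y; have [u <-] := rpi_surj x; have [v <-] := rpi_surj y => uv.
apply/rpiP/NE => a; have := uv a; rewrite -!rhom_act => /rpiP/NE/(_ e).
by rewrite !actee.
Qed.

(** From left to right, R is the kernel of the map of [ind_onto], which kills
[e_kernel] because M is minimal.  From right to left, a class killed by all the
ae comes from an element of [e_kernel], hence is the class of 0. *)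
Lemma ind_quot_minimal M : minimal V ->
  [/\ minimal M, factors M & Me c M ~= V] <->
  exists R : congruence ind,
    [/\ forall u v, R u v -> e_cong c ind u v,
        forall u v, e_kernel c ind u -> e_kernel c ind v -> R u v
      & M ~= rquot R].
Proof.
move=> minV; split=> [[minM facM MV]|[R [RN KR MR]]].
  have supM := supported_iso (proj1 minV) MV.
  have genM := minimal_e_generated minM supM.
  have [f [fS fN _]] := ind_onto facM genM (riso_sym MV).
  have fK u : e_kernel c ind u -> f u = 0.
    move=> u0; apply: (minimal_e_kernel minM supM) => a.
    by rewrite -!rhom_act u0 raddf0.
  exists (ker_cong f); split=> [|u v u0 v0|]; first exact: fN.
    by rewrite /= !fK.
  apply: (riso_of_surj fS (@rpi_surj _ _ _ (ker_cong f))) => x y.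
  by split=> [fxy|/rpiP]; first exact/rpiP.
have QV := ind_quot_Me RN.
have minQ : minimal (rquot R).
  apply: (minimal_of_Me (@ind_quot_generated R)).
    exact: minimal_iso (riso_sym QV) minV.
  move=> x; have [u <-] := rpi_surj x => u0.
  rewrite -(raddf0 (rpi R)); apply/rpiP; apply: KR; last exact: ksub0.
  move=> a; have := u0 a; rewrite -!rhom_act -(raddf0 (rpi R)) => /rpiP/RN/(_ e).
  by rewrite !actee !ract0l.
split; first exact: minimal_iso (riso_sym MR) minQ.
  have [g [gi _]] := risoP MR; exact: factors_inj gi (@ind_quot_factors R).
exact: riso_trans (Me_iso c MR) QV.
Qed.

(** ** Coinduction *)

Definition coind : rmodule A := inflation piS (hom_module (Ae c') V).

Definition e_Ae : Ae c' := ksub_in (ex_intro _ e' (esym (cee c')) : Ae_k c' e').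

Definition coind_unit (v : V) : coind.
Proof.
unshelve refine (@RHom _ _ (bimod_right (Ae c')) V
  (fun x => v ** theta (ksval (x : ksub_mod (Ae_k c')))) _ _).
- by split=> [d x|x y] /=; rewrite ?thetaZ ?ractZr ?thetaD ?ractDr.
- by move=> x b; rewrite /= theta_cr ractA.
Defined.

Definition coind_counit (f : coind) : V := (f : hom (Ae c') V) e_Ae.

Lemma coind_actE (f : coind) a (x : Ae c') :
  (f ** a : hom (Ae c') V) x = (f : hom (Ae c') V) (Ae_lact (pi a) x).
Proof. by []. Qed.

(** For x in A'e', (fe)(x) = f(e'xe') = f(e')theta(x). *)
Lemma coind_e f : f ** e = coind_unit (coind_counit f).
Proof.
apply: homP => x; rewrite coind_actE /= -rhom_act; congr (rhom_fun f _).
apply: ksval_inj; rewrite /= c'_theta pi_e !amulA cee.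
by rewrite -[in RHS]amulA (Ae_e (ksub_valP x)).
Qed.

Lemma coind_unitK v : coind_counit (coind_unit v) = v.
Proof. by rewrite /coind_counit /= theta_e (ract1 (cone_unity c')). Qed.

Lemma coind_unit_e v : coind_unit v ** e = coind_unit v.
Proof. by rewrite coind_e coind_unitK. Qed.

Definition coind_unit_hom : rhom V (Me c coind).
Proof.
unshelve refine (@RHom _ _ V (Me c coind) (fun v => me_in c (coind_unit v)) _ _).
- split=> [d v|v w]; rewrite -?me_inZ -?me_inD; congr me_in; apply: homP => x /=.
    by rewrite ractZl.
  by rewrite ractDl.
- move=> v b; apply: me_val_inj; rewrite me_val_act !me_inK !coind_unit_e.
  apply: homP => x; rewrite coind_actE /= -c'E theta_cl ractA.
  by [].
Defined.

Lemma coind_Me : V ~= Me c coind.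
Proof.
exists coind_unit_hom; exists (fun x : Me c coind => coind_counit (me_val x)) => [v|x].
  rewrite -[coind_unit_hom v]/(me_in c (coind_unit v)).
  by rewrite me_inK coind_unit_e coind_unitK.
rewrite -[LHS]/(me_in c (coind_unit _)).
by apply: (@me_val_inj _ _ _ c coind); rewrite me_inK -coind_e !me_val_e.
Qed.

(** f(ae') is the value of fae at e'. *)
Lemma coind_e_cong f g : e_cong c coind f g -> f = g.
Proof.
move=> fg; apply: homP => x; have [b xb] := ksub_valP (x : ksub_mod (Ae_k c')).
have [a ab] := piS b; have := congr1 coind_counit (fg a).
have E h : coind_counit (h ** a ** e) = (h : hom (Ae c') V) x.
  rewrite /coind_counit !coind_actE; congr (rhom_fun h _); apply: ksval_inj.
  by rewrite /= ab pi_e cee xb.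
by rewrite !E.
Qed.

Lemma coind_e_kernel f : e_kernel c coind f -> f = 0.
Proof. by move=> f0; apply: coind_e_cong => a; rewrite f0 !ract0l. Qed.

Lemma coind_span_irreducible :
  irreducible V -> irreducible (rsub (e_span c coind)).
Proof.
move=> irrV; apply: e_span_irreducible coind_e_cong _.
exact: irreducible_iso coind_Me irrV.
Qed.

Lemma coind_span_Me : Me c (rsub (e_span c coind)) ~= V.
Proof. exact: riso_trans (Me_e_span c coind) (riso_sym coind_Me). Qed.

Lemma coind_span_factors : factors (rsub (e_span c coind)).
Proof. by apply: factors_inj (@rincl_inj _ _ _ _) _; apply: factors_inflation. Qed.

End FullCorner.
(** * Finite semigroups *)

Section GreenRelations.
Variable S : finSemigroupType.
Local Open Scope group_scope.
Implicit Types (s t u : S) (e : idem S).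

Lemma principalP s t :
  reflect (exists x y, t = Defs.mul1r (mul1l x s) y) (t \in principal s).
Proof.
rewrite inE; apply: (iffP existsP) => [[x /existsP[y /eqP->]]|[x [y ->]]].
  by exists x, y.
by exists x; apply/existsP; exists y.
Qed.

Lemma principal_refl s : s \in principal s.
Proof. by apply/principalP; exists None, None. Qed.

Lemma principalS s t : (principal t \subset principal s) = (t \in principal s).
Proof.
apply/idP/idP => [/subsetP|/principalP[x [y]]]; first by apply; apply: principal_refl.
exact: principal_sub.
Qed.

Lemma principal_trans s t u :
  u \in principal t -> t \in principal s -> u \in principal s.
Proof. by rewrite -!principalS; apply: subset_trans. Qed.

Lemma principalMl s t : t * s \in principal s.
Proof. by apply/principalP; exists (Some t), None. Qed.

Lemma principalMr s t : s * t \in principal s.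
Proof. by apply/principalP; exists None, (Some t). Qed.

Lemma J_classE (J : {set S}) s :
  [exists s, J == J_class s] -> s \in J -> J = J_class s.
Proof.
by case/existsP=> t /eqP-> ; rewrite inE => /eqP st; apply/setP=> u; rewrite !inE st.
Qed.

Lemma in_Jnot s t : (t \in Jnot (J_class s)) = (s \notin principal t).
Proof.
rewrite inE; congr (~~ _); apply/subsetP/idP => [|st u].
  by apply; rewrite inE.
by rewrite inE eqEsubset !principalS => /andP[us _]; apply: principal_trans us st.
Qed.

Section UnitGroup.
Variable e0 : idem S.
Local Notation e := (ival e0).

Lemma in_eSe s : e * s * e \in eSe e0.
Proof. by apply/imsetP; exists s. Qed.

(** Left multiplication by t is injective on the finite set eSe, hence onto: so
e = tu for some u, and u = stu = s. *)
Lemma eSe_inverse s t : s \in eSe e0 -> t \in eSe e0 -> s * t = e -> t * s = e.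
Proof.
move=> /[dup] ss /eSe_e[es se] /[dup] ts /eSe_e[et te] st.
have tinj : {in eSe e0 &, injective (fun u => t * u)}.
  move=> u v /eSe_e[eu _] /eSe_e[ev _] /(congr1 (fun w => s * w)).
  by rewrite !mulgA st eu ev.
have /eqP im : [set t * u | u in eSe e0] == eSe e0.
  rewrite eqEcard card_in_imset // leqnn andbT.
  by apply/subsetP=> _ /imsetP[u us ->]; apply: eSe_M.
have : e \in [set t * u | u in eSe e0].
  by rewrite im; have := in_eSe e; rewrite !ivalP.
case/imsetP=> u us tu; rewrite tu; congr (_ * _).
by have [eu _] := eSe_e us; rewrite -{1}se tu mulgA st.
Qed.

(** If e = xsy, then e = psq with p = exe and q = eye in eSe, and in a finite
monoid the factors of a product equal to the identity are units. *)
Lemma eSe_unit s : s \in eSe e0 -> e \in principal s -> s \in maxgroup_set e0.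
Proof.
move=> /[dup] ss /eSe_e[es se] /principalP[x [y exy]].
(* x and y may be the adjoined identity. *)
pose p := e * Defs.mul1r (mul1l x e) None * e.
pose q := e * Defs.mul1r (mul1l None e) y * e.
have pS : p \in eSe e0 by apply: in_eSe.
have qS : q \in eSe e0 by apply: in_eSe.
have psq : p * s * q = e.
  have ps : p * s = e * mul1l x s.
    by rewrite /p; case: (x) => [x'|] /=; rewrite -!mulgA !es.
  rewrite ps; have ewe : e * mul1l x s * e = e * mul1l x s.
    by case: (x) => [x'|] /=; rewrite -!mulgA se.
  transitivity (e * Defs.mul1r (mul1l x s) y * e); last by rewrite -exy !ivalP.
  rewrite /q; move: (mul1l x s) ewe => w ewe; case: (y) => [y'|] /=; rewrite !mulgA.
    by rewrite !ewe.
  by rewrite !ewe.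
clearbody p q.
have h1 := eSe_inverse (eSe_M pS ss) qS psq.
have h2 : s * q * p = e.
  by apply: eSe_inverse => //; [apply: eSe_M | rewrite mulgA].
rewrite inE ss; apply/existsP; exists (q * p).
by rewrite eSe_M //= (mulgA s) h2 -mulgA h1 !eqxx.
Qed.

Lemma maxgroup_principal (g : maxgroup e0) : e \in principal (gval g).
Proof.
have := gvalP g; rewrite inE => /andP[_ /existsP[h /and3P[_ /eqP<- _]]].
exact: principalMr.
Qed.

End UnitGroup.

(** Induction on the subsemigroup X.  For a in X, unless aX is smaller than X,
the equation as = a has solutions in X, and they form a subsemigroup; when it
is not smaller than X either, a itself is a solution. *)
Lemma exists_idempotent (X : {set S}) :
  X != set0 -> {in X &, forall s t, s * t \in X} ->
  exists2 f, f \in X & f * f = f.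
Proof.
move: {2}#|X|.+1 (ltnSn #|X|) => n; elim: n X => // n IH X Xn X0 XM.
have [a aX] := set0Pn _ X0.
case: (eqVneq [set a * s | s in X] X) => [aXX|aXX].
  pose Y := [set s in X | a * s == a].
  have [YX|YX] := eqVneq Y X.
    by exists a => //; move: aX; rewrite -YX inE => /andP[_ /eqP].
  have YsX : Y \subset X by apply/subsetP=> s; rewrite inE => /andP[].
  have [||s t|f fY ff] := IH Y.
  - rewrite -ltnS; apply: leq_trans Xn; rewrite ltnS.
    by apply: proper_card; rewrite properEneq YX.
  - move: aX; rewrite -{1}aXX => /imsetP[s sX as_]; apply/set0Pn.
    by exists s; rewrite inE sX -as_ eqxx.
  - rewrite !inE => /andP[sX /eqP sa] /andP[tX /eqP ta].
    by rewrite XM // mulgA sa ta eqxx.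
  - by exists f => //; apply: (subsetP YsX).
have ZX : [set a * s | s in X] \subset X.
  by apply/subsetP=> _ /imsetP[s sX ->]; apply: XM.
have [||_ _ /imsetP[s sX ->] /imsetP[t tX ->]|f fZ ff] := IH [set a * s | s in X].
- rewrite -ltnS; apply: leq_trans Xn; rewrite ltnS.
  by apply: proper_card; rewrite properEneq aXX.
- by apply/set0Pn; exists (a * a); apply/imsetP; exists a.
- by apply/imsetP; exists (s * (a * t)); rewrite ?mulgA // !XM.
- by exists f => //; apply: (subsetP ZX).
Qed.

(** The elements p of the ideal of u such that psy = s for some y form a
subsemigroup; an idempotent p of it satisfies ps = ppsy = psy = s. *)
Lemma idempotent_fix s u : s \in principal (u * s) ->
  exists f, [/\ f \in principal u, f * f = f & f * s = s].
Proof.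
move=> /principalP[x0 [y0 s_us]].
pose X := [set p in principal u | [exists y, Defs.mul1r (p * s) y == s]].
have XE p : (p \in X) =
    (p \in principal u) && [exists y, Defs.mul1r (p * s) y == s].
  by rewrite inE.
have [||f] := @exists_idempotent X.
- apply/set0Pn; exists (mul1l x0 u); rewrite XE; apply/andP; split.
    by apply/principalP; exists x0, None.
  apply/existsP; exists y0; rewrite [X in _ == X]s_us.
  by case: x0 {s_us} => [x|]; rewrite //= mulgA.
- move=> p q; rewrite !XE => /andP[pu /existsP[y /eqP py]] /andP[_ /existsP[z /eqP qz]].
  apply/andP; split; first exact: principal_trans (principalMr p q) pu.
  apply/existsP; exists (if z is Some z' then Some (Defs.mul1r z' y) else y).
  apply/eqP; rewrite -[RHS]py -[in RHS]qz.
  by case: y {py} => [y|]; case: z {qz} => [z|] /=; rewrite !mulgA.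
rewrite XE => /andP[fu /existsP[y /eqP fy]] ff; exists f; split=> //.
by rewrite -{1}fy -[RHS]fy; case: y {fy} => [y|]; rewrite /= !mulgA ff.
Qed.

Lemma regJ_inj (J J' : regJ S) : Jnot J = Jnot J' -> J = J'.
Proof.
case: J J' => J regJ [J' regJ']; have := regJ; have := regJ'; rewrite /=.
move=> /andP[h' /existsP[f' /andP[f'J' _]]] /andP[h /existsP[f /andP[fJ _]]] JJ'.
suff E : J = J'.
  case: _ / E regJ' {h' f'J' JJ'} => regJ'.
  by congr RegJ; apply: bool_irrelevance.
rewrite (J_classE h fJ) (J_classE h' f'J') in JJ' *.
have := in_Jnot f f; rewrite JJ' in_Jnot principal_refl => /negbFE f'f.
have := in_Jnot f' f'; rewrite -JJ' in_Jnot principal_refl => /negbFE ff'.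
have E : principal f = principal f'.
  by apply/eqP; rewrite eqEsubset !principalS ff' f'f.
by apply/setP=> u; rewrite !inE E.
Qed.

End GreenRelations.
(** * Apexes of modules over a semigroup algebra *)

Section Apex.
Variables (k : comPzSemiRingType) (S : finSemigroupType).
Local Notation kS := (sgalg k S).
Implicit Types (M : rmodule kS) (s t : S).

Lemma ahom0 (A B : algebra k) (f : alghom A B) : f 0 = 0.
Proof. exact: raddf0. Qed.
Lemma ahomD (A B : algebra k) (f : alghom A B) a b : f (a + b) = f a + f b.
Proof. exact: raddfD. Qed.
Lemma ahomZ (A B : algebra k) (f : alghom A B) d a : f (d *: a) = d *: f a.
Proof. exact: linearZ. Qed.

Lemma delta_mul s t :
  amul (sgdelta k s : kS) (sgdelta k t) = sgdelta k (s * t)%g.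
Proof. exact: sgmul_delta. Qed.

Lemma act_delta M (m : M) s t :
  m ** sgdelta k s ** sgdelta k t = m ** sgdelta k (s * t)%g.
Proof. by rewrite ractA delta_mul. Qed.

Lemma act_span_eq0 M (m : M) (X : {set S}) (n : kS) :
  (forall s, s \in X -> m ** sgdelta k s = 0) -> sgspan k X n -> m ** n = 0.
Proof.
move=> mX nX; rewrite [n]sg_decomp.
apply: (big_ind (fun a : kS => m ** a = 0)) => [|a b a0 b0|s _].
- exact: ract0r.
- by rewrite ractDr a0 b0 addr0.
rewrite ractZr; have [/mX->|/nX->] := boolP (s \in X); first by rewrite scaler0.
exact: scale0r.
Qed.

Lemma Ann_principal M s t : Ann M s -> t \in principal s -> Ann M t.
Proof.
move=> sM /principalP[x [y ->]] m; have E : m ** sgdelta k (mul1l x s) = 0.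
  by case: x => [x|] //=; rewrite -act_delta.
by case: y => [y|] //=; rewrite -act_delta E ract0l.
Qed.

Section AtIdempotent.
Variables (J : {set S}) (e : idem S).
Hypothesis JE : J = J_class (ival e).
Local Notation pi := (AJproj k J).
Local Notation c' := (AJ_corner k e J).
Local Notation c := (kS_corner k e).

Lemma AJproj_eq (a b : kS) : pi a = pi b <-> ideal_rel (kJnot k J) a b.
Proof. exact: kpiP. Qed.

(** An element of kG is read off at the elements of G, where the elements of
kJ^{not up} vanish. *)
Lemma AJ_corner_inj : injective c'.
Proof.
move=> f g /AJproj_eq[n [n' [/= nJ n'J fg]]]; apply/ffunP=> h.
have hJ : gval h \notin Jnot J by rewrite JE in_Jnot negbK maxgroup_principal.
have E (b : sgalg k (maxgroup e)) : kG_incl b (gval h) = b h.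
  rewrite /kG_incl sum_ffunE (bigD1 h) //= !ffunE eqxx [_ *: _]mulr1.
  rewrite big1 ?addr0 // => i ih; rewrite !ffunE.
  by rewrite (inj_eq val_inj) eq_sym (negPf ih) [_ *: _]mulr0.
have := congr1 (fun u : {ffun S -> k^o} => u (gval h)) fg.
by rewrite !ffunE nJ // n'J // !addr0 !E.
Qed.

(** For s in S, ese is in G or in J^{not up}. *)
Lemma AJ_corner_full a :
  exists b, c' b = amul (amul (ce c') a) (ce c').
Proof.
have [f <-] := AJproj_surj a; rewrite -!ahomM.
elim/sg_ind: f => [|f g [b bf] [b' b'g]|d s].
- by exists 0; rewrite amul0r amul0l !ahom0.
- by exists (b + b'); rewrite amulDr amulDl !ahomD bf b'g.
rewrite amulZr amulZl ahomZ !delta_mul.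
have [sG|sG] := boolP (ival e * s * ival e \in maxgroup_set e)%g.
  exists (d *: sgdelta k (MaxGroup sG)).
  by rewrite ahomZ [kG_AJ _ _ _ _]/(pi _) /= kG_incl_delta.
exists 0; rewrite ahom0; suff -> : pi (sgdelta k (ival e * s * ival e)%g) = 0.
  by rewrite scaler0.
rewrite -(ahom0 pi); apply/AJproj_eq.
exists 0, (sgdelta k (ival e * s * ival e)%g).
split; rewrite ?addr0 ?add0r //; first exact: ksub0.
move=> t tJ; rewrite ffunE; case: eqP => // ts; case/negP: sG; rewrite -ts.
apply: eSe_unit; first by rewrite ts in_eSe.
by move: tJ; rewrite JE in_Jnot negbK.
Qed.

Lemma factorsP M : factors pi M <-> forall s, s \in Jnot J -> Ann M s.
Proof.
split=> [facM s sJ m|annM a b /AJproj_eq[n [n' [nJ n'J ab]]] m].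
  rewrite -(ract0r m); apply: facM; apply/AJproj_eq.
  exists 0, (sgdelta k s); split; rewrite ?addr0 ?add0r //; first exact: ksub0.
  by move=> t tJ; rewrite ffunE; case: eqP => // ts; rewrite ts sJ in tJ.
rewrite -[LHS]addr0 -[RHS]addr0 -{1}(act_span_eq0 (fun s sJ => annM s sJ m) nJ).
by rewrite -(act_span_eq0 (fun s sJ => annM s sJ m) n'J) -!ractDr ab.
Qed.

(** Every s outside J^{not up} has e in its ideal; so if s annihilates M, then e
does. *)
Lemma apexP M :
  (forall s, Ann M s <-> s \in Jnot J) <-> factors pi M /\ supported c M.
Proof.
split=> [apM|[/factorsP facM [m me0]] s].
  split; first by apply/factorsP => s /apM.
  apply: contrapT => nsup; have : ival e \in Jnot J.
    by apply/apM => m; apply: contrapT => me0; apply: nsup; exists m.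
  by rewrite JE in_Jnot principal_refl.
split=> [annMs|]; last exact: facM.
rewrite JE in_Jnot; apply/negP => /(Ann_principal annMs) => /(_ m).
exact: me0.
Qed.

End AtIdempotent.

Definition ideal_ann M t : submodule M.
Proof.
unshelve refine (@Submodule _ _ M (@KSub _ M
  (fun m => forall v, v \in principal t -> m ** sgdelta k v = 0) _ _ _) _) => /=.
- by move=> v _; apply: ract0l.
- by move=> m n m0 n0 v vt; rewrite ractDl m0 // n0 // addr0.
- by move=> d m m0 v vt; rewrite ractZl m0 // scaler0.
move=> m a m0 v vt; elim/sg_ind: a => [|a b a0 b0|d s].
- by rewrite ract0r ract0l.
- by rewrite ractDr ractDl a0 b0 addr0.
rewrite ractZr ractZl act_delta m0 ?scaler0 //.
exact: principal_trans (principalMl v s) vt.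
Defined.

(** Otherwise Mu would be contained in [ideal_ann] for every u in the ideal of s.
But [ideal_ann] is not all of M, so it is 0, and s would annihilate M. *)
Lemma factor_Ann M s t :
  (forall W : submodule M, submod_zero W \/ submod_full W) ->
  ~ Ann M s -> ~ Ann M t -> exists2 u, u \in principal s & ~ Ann M (u * t)%g.
Proof.
move=> minM sM tM; apply: contrapT => h.
have ut0 u : u \in principal s -> Ann M (u * t)%g.
  by move=> us; apply: contrapT => nut; apply: h; exists u.
have [W0|W1] := minM (ideal_ann M t); last first.
  by apply: tM => m; apply: W1; apply: principal_refl.
apply: sM => m; apply: W0 => v /principalP[x [y ->]].
have E : m ** sgdelta k s ** sgdelta k (mul1l x t) = 0.
  rewrite act_delta; case: x => [x|] /=; last exact/ut0/principal_refl.
  by rewrite mulgA; apply/ut0/principalMr.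
by case: y => [y|] //=; rewrite -act_delta E ract0l.
Qed.

(** An element s outside the annihilator with a smallest ideal is in the ideal of
every t outside the annihilator: some ut, with u in the ideal of s, is outside,
and its ideal, contained in that of s, is equal to it. *)
Lemma minimal_apex M : minimal M -> exists J : regJ S, apex M J.
Proof.
case=> [[m0 [a0 ma0]] minM].
have [s0 s0M] : exists s, ~ Ann M s.
  apply: contrapT => h; apply: ma0.
  apply: (@act_span_eq0 _ _ setT) => [s _|s]; last by rewrite inE.
  by move: m0; apply: contrapT => ns; apply: h; exists s.
pose P s := ~~ `[< Ann M s >].
have PE s : reflect (~ Ann M s) (P s).
  by rewrite /P; apply: (iffP idP) => [/asboolPn|/asboolPn].
have [s Ps smin] :=
  @arg_minnP S s0 P (fun s => #|principal s|) (introT (PE s0) s0M).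
have sM := elimT (PE s) Ps.
have minJ t : ~ Ann M t -> t \in principal s -> s \in principal t.
  move=> tM; rewrite -principalS => ts; rewrite -principalS.
  have : principal t == principal s by rewrite eqEcard ts smin //; apply/PE.
  by move/eqP->.
(* An idempotent f with fs = s is not in the annihilator. *)
have [u us usM] := factor_Ann minM sM sM.
have usJ : s \in principal (u * s)%g.
  by apply: minJ => //; apply: principalMl.
have [f [fu ff fs]] := idempotent_fix usJ.
have fs' : f \in principal s by apply: principal_trans fu us.
have fM : ~ Ann M f.
  by move=> fM; apply: sM => m; rewrite -fs -act_delta fM ract0l.
have fJ : f \in J_class s.
  by rewrite inE eqEsubset !principalS fs' minJ.
have regJ : regular_J_class (J_class s).
  apply/andP; split; first by apply/existsP; exists s.
  by apply/existsP; exists f; rewrite fJ ff eqxx.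
exists (RegJ regJ) => t /=; rewrite in_Jnot; split.
  by move=> tM; apply/negP => /(Ann_principal tM).
move=> /negP st; apply: contrapT => tM; apply: st.
have [v vs vtM] := factor_Ann minM sM tM.
apply: principal_trans (principalMl t v); apply: minJ => //.
exact: principal_trans (principalMr v t) vs.
Qed.

Lemma apex_iso M N (J : regJ S) : M ~= N -> apex M J -> apex N J.
Proof.
move=> /risoP[f [fi fS]] apM s; split=> [annNs|/apM annMs n].
  by apply/apM => m; apply: fi; rewrite rhom_act annNs raddf0.
by have [m <-] := fS n; rewrite -rhom_act annMs raddf0.
Qed.

Lemma apex_unique M (J J' : regJ S) : apex M J -> apex M J' -> J = J'.
Proof.
move=> apJ apJ'; apply: regJ_inj; apply/setP=> s.
by apply/idP/idP => [/apJ/apJ'|/apJ'/apJ].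
Qed.

End Apex.
(** * Classification *)

Section Classes.
Variables (k : comPzSemiRingType) (A : algebra k).

Lemma iso_classP (M : rmodule A) : irreducible M ->
  exists N, irreducible N /\ (forall N', N' ~= M <-> N' ~= N).
Proof. by move=> irrM; exists M. Qed.

Definition iso_class (M : rmodule A) (irrM : irreducible M) : irr_class A :=
  IrrClass (iso_classP irrM).

Lemma class_iso (C : irr_class A) (M N : rmodule A) : C M -> C N -> M ~= N.
Proof.
have [P [_ CP]] := irr_memP C.
by move=> /CP MP /CP NP; apply: riso_trans MP (riso_sym NP).
Qed.

Lemma class_closed (C : irr_class A) (M N : rmodule A) : C M -> N ~= M -> C N.
Proof.
by have [P [_ CP]] := irr_memP C => /CP MP NM; apply/CP/(riso_trans NM).
Qed.

Lemma class_rep (C : irr_class A) : exists M, irreducible M /\ C M.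
Proof.
by have [P [irrP CP]] := irr_memP C; exists P; split=> //; apply/CP/riso_refl.
Qed.

Lemma class_eq (C D : irr_class A) (M : rmodule A) : C M -> D M -> C = D.
Proof.
move=> CM DM; have E : irr_mem C = irr_mem D.
  apply/funext => N; apply/propext; split=> h.
    by apply: class_closed DM (class_iso h CM).
  by apply: class_closed CM (class_iso h DM).
case: C D E {CM DM} => [C hC] [D hD] /= E; case: _ / E hD => hD.
by congr IrrClass; apply: Prop_irrelevance.
Qed.

End Classes.

Lemma inj_surj_bij (T U : Type) (f : T -> U) :
  injective f -> surj f -> bijective f.
Proof.
move=> fi fS; exists (fun y => sval (cid (fS y))) => [x|y]; last by case: cid.
by apply: fi; case: cid.
Qed.

(** * Modules with a given apex *)

Section GivenApex.
Variables (k : comPzSemiRingType) (S : finSemigroupType).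
Variables (J : regJ S) (e : idem S).
Hypothesis JE : jset J = J_class (ival e).
Local Notation kS := (sgalg k S).
Local Notation kG := (sgalg k (maxgroup e)).
Local Notation pi := (AJproj k J).
Local Notation c := (kS_corner k e).
Implicit Types (M : rmodule kS) (V : rmodule kG).

Let piS := @AJproj_surj k S J.
Let c'E b : AJ_corner k e J b = pi (c b) := erefl.
Let c'_inj : injective (AJ_corner k e J) := AJ_corner_inj JE.
Let c'_full := @AJ_corner_full k S J e JE.

Definition lies_over V M := [/\ irreducible M, apex M J & Me c M ~= V].

Lemma apex_intro V M :
  nonzero_action V -> factors pi M -> Me c M ~= V -> apex M J.
Proof.
by move=> Vnz facM MV; apply/(apexP JE); split=> //; apply: supported_iso Vnz MV.
Qed.

Lemma apex_minimal_Me M : apex M J -> minimal M -> minimal (Me c M).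
Proof.
move=> /(apexP JE)[facM supM]; apply: minimal_Me => //.
exact: (factors_e_factors c'E c'_full).
Qed.

Lemma apex_irreducible_Me M : apex M J -> irreducible M -> irreducible (Me c M).
Proof.
move=> apM [simM minM]; split; last exact: apex_minimal_Me.
have /(apexP JE)[facM supM] := apM; apply: simple_Me => //.
exact: (factors_e_factors c'E c'_full).
Qed.

Lemma lies_over_unique V M N :
  irreducible V -> lies_over V M -> lies_over V N -> M ~= N.
Proof.
move=> irrV [irrM /(apexP JE)[facM _] MV] [irrN /(apexP JE)[facN _] NV].
exact: (ind_irreducible_unique piS c'E c'_inj c'_full irrV).
Qed.

Lemma NcongE V u v : Ncong J V u v <-> e_cong c (Ind J V) u v.
Proof.
split=> uv a; first exact: uv.
by have [b <-] := piS a; apply: uv.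
Qed.

Lemma KsubE V u : Ksub J V u <-> e_kernel c (Ind J V) u.
Proof.
split=> u0 a; first exact: u0.
by have [b <-] := piS a; apply: u0.
Qed.

Lemma Ncong_maximal V : irreducible V -> unique_maximal_cong (Ncong J V).
Proof.
move=> [simV _]; apply: (e_cong_unique_maximal (@NcongE V)).
  exact: (@ind_generated _ _ _ _ _ piS c _ c'E V).
exact: simple_iso (ind_Me piS c'E c'_inj c'_full V) simV.
Qed.

Lemma Ksub_maximal V : minimal V -> unique_maximal_submod (Ksub J V).
Proof.
move=> minV; apply: (e_kernel_unique_maximal (@KsubE V)).
  exact: (@ind_generated _ _ _ _ _ piS c _ c'E V).
exact: minimal_iso (ind_Me piS c'E c'_inj c'_full V) minV.
Qed.

Lemma Coind_e_kS_minimal V : irreducible V ->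
  unique_minimal_submod (Coind_e_kS J V).
Proof.
move=> [_ minV].
apply: (e_span_unique_minimal (@coind_e_kernel _ _ _ _ _ piS c _ c'E V)).
exact: minimal_iso (coind_Me piS c'E c'_inj c'_full V) minV.
Qed.

Lemma Ind_lies_over V : irreducible V -> lies_over V (rquot (Ncong J V)).
Proof.
move=> irrV; have MV : Me c (rquot (Ncong J V)) ~= V.
  by apply: (ind_quot_Me c'E c'_inj c'_full) => u v /NcongE.
split=> //.
  exact: (ind_quot_irreducible c'E c'_inj c'_full (@NcongE V)).
by apply: apex_intro MV; [case: irrV => [[]] | apply: ind_quot_factors].
Qed.

Lemma Coind_lies_over V : irreducible V -> lies_over V (rsub (Coind_e_kS J V)).
Proof.
move=> irrV; have MV : Me c (rsub (Coind_e_kS J V)) ~= V.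
  exact: (coind_span_Me piS c'E c'_inj c'_full).
split=> //; first exact: (coind_span_irreducible piS c'E c'_inj c'_full).
apply: apex_intro MV; first by case: irrV => [[]].
exact: (@coind_span_factors _ _ _ _ _ piS c (AJ_corner k e J) V).
Qed.

Lemma minimal_lies_over V M : minimal V ->
  [/\ minimal M, apex M J & Me c M ~= V] <->
  exists R : congruence (Ind J V),
    [/\ forall u v, R u v -> Ncong J V u v,
        forall u v, Ksub J V u -> Ksub J V v -> R u v
      & M ~= rquot R].
Proof.
move=> minV.
have H := ind_quot_minimal piS c'E c'_inj c'_full M minV.
split=> [[minM /(apexP JE)[facM _] MV]|[R [RN KR MR]]].
  have [R [RN KR MR]] := proj1 H (And3 minM facM MV).
  by exists R; split=> // [u v /RN/NcongE //|u v /KsubE u0 /KsubE]; apply: KR.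
have [|minM facM MV] := proj2 H _.
  by exists R; split=> // [u v /RN/NcongE //|u v /KsubE u0 /KsubE]; apply: KR.
by split=> //; apply: apex_intro MV => //; case: minV.
Qed.

End GivenApex.

Theorem theorem3p5 (k : comPzSemiRingType) (S : finSemigroupType)
    (E : regJ S -> idem S) (hE : forall J : regJ S, ival (E J) \in jset J) :
  let kS := sgalg k S in
  let kG (J : regJ S) := sgalg k (maxgroup (E J)) in
  let Me_ (J : regJ S) (M : rmodule kS) : rmodule (kG J) :=
    Me (kS_corner k (E J)) M in
  (forall J : regJ S,
    (forall M : rmodule kS, apex M J ->
      (irreducible M -> irreducible (Me_ J M)) /\
      (minimal M -> minimal (Me_ J M))) /\
    (forall V : rmodule (kG J), irreducible V ->
      unique_maximal_cong (Ncong J V) /\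
      unique_up_to_iso
        (fun M : rmodule kS => [/\ irreducible M, apex M J & Me_ J M ~= V])
        (rquot (Ncong J V))) /\
    (forall V : rmodule (kG J), irreducible V ->
      unique_minimal_submod (Coind_e_kS J V) /\
      unique_up_to_iso
        (fun M : rmodule kS => [/\ irreducible M, apex M J & Me_ J M ~= V])
        (rsub (Coind_e_kS J V))) /\
    (forall V : rmodule (kG J), minimal V ->
      unique_maximal_submod (Ksub J V) /\
      forall M : rmodule kS,
        [/\ minimal M, apex M J & Me_ J M ~= V] <->
        exists R : congruence (Ind J V),
          [/\ forall u v, R u v -> Ncong J V u v,
              forall u v, Ksub J V u -> Ksub J V v -> R u v
            & M ~= rquot R])) /\
  exists f : irr_class kS -> {J : regJ S & irr_class (kG J)},
    bijective f /\
    forall (C : irr_class kS) (M : rmodule kS), C M ->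
      apex M (tag (f C)) /\ tagged (f C) (Me_ (tag (f C)) M).
Proof.
move=> kS kG Me_.
have JE (J : regJ S) : jset J = J_class (ival (E J)).
  by have /andP[Jh _] := jsetP J; apply: J_classE (hE J).
split=> [J|].
  split; last split; last split.
  - move=> M apM; split; first exact: (apex_irreducible_Me (JE J)).
    exact: (apex_minimal_Me (JE J)).
  - move=> V irrV; have NV := Ind_lies_over (JE J) irrV.
    split; first exact: (Ncong_maximal (JE J)).
    by split=> // M MV; exact: (lies_over_unique (JE J) irrV MV NV).
  - move=> V irrV; have CV := Coind_lies_over (JE J) irrV.
    split; first exact: (Coind_e_kS_minimal (JE J)).
    by split=> // M MV; exact: (lies_over_unique (JE J) irrV MV CV).
  - move=> V minV; split; first exact: (Ksub_maximal (JE J)).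
    by move=> M; apply: (minimal_lies_over (JE J)).
(* The class C goes to the apex J of a representative M, with the class of
   M e_J. *)
have rep (C : irr_class kS) : {M : rmodule kS | irreducible M /\ C M}.
  exact/cid/class_rep.
have apx (C : irr_class kS) : {J : regJ S | apex (sval (rep C)) J}.
  by apply/cid/minimal_apex; case: (rep C) => M [[]].
have irrMe C :=
  apex_irreducible_Me (JE _) (svalP (apx C)) (proj1 (svalP (rep C))).
pose f (C : irr_class kS) : {J : regJ S & irr_class (kG J)} :=
  existT _ (sval (apx C)) (iso_class (irrMe C)).
have fP (C : irr_class kS) (M : rmodule kS) : C M ->
    apex M (tag (f C)) /\ tagged (f C) (Me_ (tag (f C)) M).
  move=> CM; have [irrN CN] := svalP (rep C).
  have MN := class_iso CM CN; split=> /=; last exact: Me_iso.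
  exact: apex_iso (riso_sym MN) (svalP (apx C)).
exists f; split=> //; apply: inj_surj_bij => [C D fCD|[J D]].
  have [M [irrM CM]] := class_rep C; have [N [irrN DN]] := class_rep D.
  have [apM MeM] := fP C M CM; have [apN MeN] := fP D N DN.
  rewrite fCD in apM MeM.
  have MN : M ~= N.
    apply: (lies_over_unique (JE _) (apex_irreducible_Me (JE _) apN irrN)).
      by split=> //; apply: class_iso MeM MeN.
    by split=> //; apply: riso_refl.
  exact: class_eq CM (class_closed DN MN).
have [V [irrV DV]] := class_rep D.
have [irrM apM MV] := Ind_lies_over (JE J) irrV.
pose C := iso_class irrM; exists C.
have [] := fP C _ (riso_refl _); case: (f C) => J' D' /= apM' D'M.
have EJ := apex_unique apM' apM; subst J'.
by congr existT; apply: class_eq D'M (class_closed DV MV).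
Qed.
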